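(* Let $C$ be the infinite cyclic group, let $M$ be a $C$-module such that $M\otimes\mathbb Q$ is finite dimensional over $\mathbb Q$, and let $G=M\rtimes C$. Then the map $H_n(G,\mathbb Q)\to H_n(\hat G_{\mathbb Q},\mathbb Q)$ induced by the canonical homomorphism $G\to\hat G_{\mathbb Q}$ is an epimorphism for any $n$.
   Context: The lower $\mathbb Q$-central series is $\gamma_1^{\mathbb Q}G=G$, $\gamma_{i+1}^{\mathbb Q}G=\mathrm{Ker}(\gamma_i^{\mathbb Q}G\to \gamma_i^{\mathbb Q}G/[\gamma_i^{\mathbb Q}G,G]\otimes \mathbb Q)$, and the $\mathbb Q$-completion is $\hat G_{\mathbb Q}=\varprojlim (G/\gamma_i^{\mathbb Q}G\otimes\mathbb Q)$, where $-\otimes\mathbb Q$ is the Malcev completion (rationalization) of a nilpotent group. Homology of $\hat G_{\mathbb Q}$ is that of the underlying discrete group. For $G=M\rtimes C$ it is known that $\hat G_{\mathbb Q}=(M\otimes\mathbb Q)^\wedge_I\rtimes\mathbb Q$, where $I$ is the augmentation ideal of $\mathbb Z[C]$ and $V^\wedge_I=\varprojlim V/VI^i$. *)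

(* Defs.v *)
From HB Require Import structures.
From mathcomp Require Import all_boot all_algebra.
From mathcomp Require Import boolp.
From mathcomp Require Import freeg.

Set Implicit Arguments.
Unset Strict Implicit.
Unset Printing Implicit Defensive.

Import GRing.Theory.
Local Open Scope ring_scope.
Local Open Scope quotient_scope.
Local Open Scope group_scope.

HB.mixin Record isConjgClosed (G : groupType) (N : {pred G}) := {
  gpredJr : forall x y : G, x \in N -> x ^ y \in N
}.

#[short(type="normalClosed")]
HB.structure Definition NormalClosed (G : groupType) :=
  {N of isConjgClosed G N & GroupClosed G N}.

Section FullGroup.
Variable G : groupType.

Definition gfull : {pred G} := predT.
HB.instance Definition _ := isMulClosed.Build G gfull (fun _ _ _ _ => isT).
HB.instance Definition _ := isMul1Closed.Build G gfull isT.
HB.instance Definition _ := isInvClosed.Build G gfull (fun _ _ => isT).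
HB.instance Definition _ := isConjgClosed.Build G gfull (fun _ _ _ => isT).

End FullGroup.
Arguments gfull : clear implicits.

Section Subgroup.
Variables (G : groupType) (H : groupClosed G).

Record subgroup := Subgroup { sgval :> G; _ : sgval \in H }.
HB.instance Definition _ := [isSub for sgval].
HB.instance Definition _ := [Choice of subgroup by <:].

Lemma subgroup_closed : group_closed H.
Proof. by split; [exact: gpred1 | exact: gpredF]. Qed.

HB.instance Definition _ := SubChoice_isSubGroup.Build G _ subgroup subgroup_closed.

End Subgroup.

Section QuotientGroup.
Variables (G : groupType) (N : normalClosed G).

Definition quotg_equiv (x y : G) := x^-1 * y \in N.

Lemma quotg_equiv_is_equiv : equiv_class_of quotg_equiv.
Proof.
split=> [x|x y|y x z]; rewrite /quotg_equiv.
- by rewrite mulVg gpred1.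
- by rewrite -gpredV invgM invgK.
move=> xy yz; have -> : x^-1 * z = x^-1 * y * (y^-1 * z) by rewrite -mulgA mulVKg.
by rewrite gpredM.
Qed.

Canonical quotg_equiv_rel := EquivRelPack quotg_equiv_is_equiv.
Canonical quotg_equiv_encModRel := defaultEncModRel quotg_equiv.

Definition quotg := {eq_quot quotg_equiv}.
HB.instance Definition _ : EqQuotient G quotg_equiv quotg := EqQuotient.on quotg.
HB.instance Definition _ := Choice.on quotg.

Lemma quotg_eqP (x y : G) : reflect (x = y %[mod quotg]) (x^-1 * y \in N).
Proof. exact: (eqmodP quotg_equiv_rel). Qed.

Definition quotg_mul := lift_op2 quotg (fun x y : G => x * y).
Definition quotg_one : quotg := \pi_quotg 1.
Definition quotg_inv := lift_op1 quotg (fun x : G => x^-1).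

Lemma quotg_pi_mul (x y : G) :
  \pi_quotg (x * y) = quotg_mul (\pi_quotg x) (\pi_quotg y).
Proof.
unlock quotg_mul; apply/quotg_eqP.
have /quotg_eqP xN : x = repr (\pi_quotg x) %[mod quotg] by rewrite reprK.
have /quotg_eqP yN : y = repr (\pi_quotg y) %[mod quotg] by rewrite reprK.
move: (repr _) (repr _) xN yN => x' y' yN xN.
have -> : (x * y)^-1 * (y' * x') = (x^-1 * y') ^ y * (y^-1 * x').
  by rewrite /conjg invgM !mulgA mulgK.
by rewrite gpredM // gpredJr.
Qed.

Lemma quotg_pi_inv (x : G) : \pi_quotg x^-1 = quotg_inv (\pi_quotg x).
Proof.
unlock quotg_inv; apply/quotg_eqP.
have /quotg_eqP : repr (\pi_quotg x) = x %[mod quotg] by rewrite reprK.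
move: (repr _) => x' xN.
have -> : x^-1^-1 * x'^-1 = (x'^-1 * x) ^ x'^-1.
  by rewrite /conjg !invgK !mulgA mulgV mul1g.
exact: gpredJr.
Qed.

Lemma quotg_mulA : associative quotg_mul.
Proof.
by elim/quotW=> x; elim/quotW=> y; elim/quotW=> z; rewrite -!quotg_pi_mul mulgA.
Qed.
Lemma quotg_mul1 : left_id quotg_one quotg_mul.
Proof. by elim/quotW=> x; rewrite -quotg_pi_mul mul1g. Qed.
Lemma quotg_mulr1 : right_id quotg_one quotg_mul.
Proof. by elim/quotW=> x; rewrite -quotg_pi_mul mulg1. Qed.
Lemma quotg_mulV : left_inverse quotg_one quotg_inv quotg_mul.
Proof. by elim/quotW=> x; rewrite -quotg_pi_inv -quotg_pi_mul mulVg. Qed.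
Lemma quotg_mulrV : right_inverse quotg_one quotg_inv quotg_mul.
Proof. by elim/quotW=> x; rewrite -quotg_pi_inv -quotg_pi_mul mulgV. Qed.

HB.instance Definition _ := isGroup.Build quotg quotg_mulA quotg_mul1
  quotg_mulr1 quotg_mulV quotg_mulrV.

Definition quotg_pi (x : G) : quotg := \pi_quotg x.

HB.instance Definition _ := isUMagmaMorphism.Build G quotg quotg_pi
  (erefl, quotg_pi_mul).

End QuotientGroup.

(** [commG H] is [[H, G]], the subgroup of [G] generated by the commutators
    [[~ x, y]] with [x] in [H] and [y] in [G]. *)
Section CommutatorSubgroup.
Variables (G : groupType).

Definition commG (H : {pred G}) : {pred G} := fun z =>
  `[< forall K : groupClosed G,
        (forall x y : G, x \in H -> [~ x, y] \in K) -> z \in K >].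

Variable H : {pred G}.

Lemma commG_mul : mulg_closed (commG H).
Proof.
move=> x y /asboolP xH /asboolP yH; apply/asboolP => K HK.
by rewrite gpredM // ?xH ?yH.
Qed.
Lemma commG_one : 1 \in commG H.
Proof. by apply/asboolP => K _; exact: gpred1. Qed.
Lemma commG_inv : invg_closed (commG H).
Proof. by move=> x /asboolP xH; apply/asboolP => K HK; rewrite gpredV xH. Qed.
HB.instance Definition _ := isMulClosed.Build G (commG H) commG_mul.
HB.instance Definition _ := isMul1Closed.Build G (commG H) commG_one.
HB.instance Definition _ := isInvClosed.Build G (commG H) commG_inv.

Lemma mem_commG x y : x \in H -> [~ x, y] \in commG H.
Proof. by move=> xH; apply/asboolP => K; apply. Qed.

End CommutatorSubgroup.

Section QuotientModule.
Variables (R : pzRingType) (V : lmodType R) (W : submodClosed V).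

Definition quotm_equiv (x y : V) := (x - y)%R \in W.

Lemma quotm_equiv_is_equiv : equiv_class_of quotm_equiv.
Proof.
have WN (x : V) : x \in W -> (- x)%R \in W by rewrite -scaleN1r; exact: rpredZ.
split=> [x|x y|y x z]; rewrite /quotm_equiv.
- by rewrite subrr rpred0.
- by apply/idP/idP => /WN; rewrite opprB.
by move=> xy yz; rewrite -(subrKA y) rpredD.
Qed.

Canonical quotm_equiv_rel := EquivRelPack quotm_equiv_is_equiv.
Canonical quotm_equiv_encModRel := defaultEncModRel quotm_equiv.

Definition quotm := {eq_quot quotm_equiv}.
HB.instance Definition _ : EqQuotient V quotm_equiv quotm := EqQuotient.on quotm.
HB.instance Definition _ := Choice.on quotm.

Lemma quotm_eqP (x y : V) : reflect (x = y %[mod quotm]) ((x - y)%R \in W).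
Proof. exact: (eqmodP quotm_equiv_rel). Qed.

Lemma quotm_reprP (x : V) : (x - repr (\pi_quotm x))%R \in W.
Proof. by apply/quotm_eqP; rewrite reprK. Qed.

Definition quotm_add := lift_op2 quotm (fun x y : V => x + y)%R.
Definition quotm_zero : quotm := \pi_quotm 0%R.
Definition quotm_scale (a : R) := lift_op1 quotm (fun x : V => a *: x)%R.
Definition quotm_opp := quotm_scale (-1).

Lemma quotm_pi_add (x y : V) :
  \pi_quotm (x + y)%R = quotm_add (\pi_quotm x) (\pi_quotm y).
Proof.
unlock quotm_add; apply/quotm_eqP.
by rewrite opprD addrACA rpredD // quotm_reprP.
Qed.

Lemma quotm_pi_scale a (x : V) :
  \pi_quotm (a *: x)%R = quotm_scale a (\pi_quotm x).
Proof.
unlock quotm_scale; apply/quotm_eqP.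
by rewrite -scalerBr rpredZ // quotm_reprP.
Qed.

Lemma quotm_addA : associative quotm_add.
Proof.
by elim/quotW=> x; elim/quotW=> y; elim/quotW=> z; rewrite -!quotm_pi_add addrA.
Qed.
Lemma quotm_addC : commutative quotm_add.
Proof. by elim/quotW=> x; elim/quotW=> y; rewrite -!quotm_pi_add addrC. Qed.
Lemma quotm_add0 : left_id quotm_zero quotm_add.
Proof. by elim/quotW=> x; rewrite -quotm_pi_add add0r. Qed.
Lemma quotm_addN : left_inverse quotm_zero quotm_opp quotm_add.
Proof.
by elim/quotW=> x; rewrite /quotm_opp -quotm_pi_scale -quotm_pi_add scaleN1r addNr.
Qed.

HB.instance Definition _ := GRing.isZmodule.Build quotm quotm_addA quotm_addC
  quotm_add0 quotm_addN.

Let pi_addr (x y : V) :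
  \pi_quotm (x + y)%R = (\pi_quotm x + \pi_quotm y)%R.
Proof. exact: quotm_pi_add. Qed.

Lemma quotm_scaleA a b x :
  quotm_scale a (quotm_scale b x) = quotm_scale (a * b)%R x.
Proof. by elim/quotW: x => x; rewrite -!quotm_pi_scale scalerA. Qed.
Lemma quotm_scale1 : left_id 1%R quotm_scale.
Proof. by elim/quotW=> x; rewrite -quotm_pi_scale scale1r. Qed.
Lemma quotm_scaleDr : right_distributive quotm_scale +%R.
Proof.
by move=> a; elim/quotW=> x; elim/quotW=> y;
  rewrite -pi_addr -!quotm_pi_scale -pi_addr scalerDr.
Qed.
Lemma quotm_scaleDl v : {morph quotm_scale^~ v : a b / (a + b)%R}.
Proof.
by elim/quotW: v => x a b; rewrite -!quotm_pi_scale -pi_addr scalerDl.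
Qed.

HB.instance Definition _ := GRing.Zmodule_isLmodule.Build R quotm
  quotm_scaleA quotm_scale1 quotm_scaleDr quotm_scaleDl.

Definition quotm_pi (x : V) : quotm := \pi_quotm x.

Lemma quotm_pi_is_linear : linear quotm_pi.
Proof. by move=> a x y; rewrite /quotm_pi quotm_pi_add quotm_pi_scale. Qed.

HB.instance Definition _ := GRing.isLinear.Build R V quotm _ quotm_pi
  quotm_pi_is_linear.

End QuotientModule.

Section Span.
Variables (R : pzRingType) (V : lmodType R) (S : V -> Prop).

Definition spanm : {pred V} := fun v =>
  `[< forall W : submodClosed V, (forall w, S w -> w \in W) -> v \in W >].

Lemma spanm_submod : submod_closed spanm.
Proof.
split=> [|a u v /asboolP uS /asboolP vS]; apply/asboolP => W SW.
  exact: rpred0.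
by rewrite rpredD ?rpredZ ?uS ?vS.
Qed.

HB.instance Definition _ := GRing.isSubmodClosed.Build R V spanm spanm_submod.

Lemma mem_spanm v : S v -> v \in spanm.
Proof. by move=> Sv; apply/asboolP => W; apply. Qed.

End Span.

(** For an abelian group [A], written multiplicatively, [tensQ A] is the
    tensor product of [A] with the rationals over the integers: extension of
    scalars presents it as the rational vector space on the symbols [<<x>>],
    standing for x ⊗ 1, modulo the relations [<<x * y>> = <<x>> + <<y>>].
    (For a nonabelian [A] it is the tensor product of the abelianization.) *)
Section TensQ.
Variable A : groupType.

Definition tensQ_rel (v : {freeg A / rat}) : Prop :=
  exists x y : A, v = (<< (x * y)%g >> - << x >> - << y >>)%R.

Definition tensQ := quotm (spanm tensQ_rel).
HB.instance Definition _ := GRing.Lmodule.on tensQ.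

Definition tensQ_in (x : A) : tensQ := quotm_pi (spanm tensQ_rel) << x >>.

Lemma tensQ_inM x y : tensQ_in (x * y) = (tensQ_in x + tensQ_in y)%R.
Proof.
rewrite /tensQ_in -raddfD; apply/quotm_eqP.
by rewrite opprD addrA; apply: mem_spanm; exists x, y.
Qed.

Lemma tensQ_in1 : tensQ_in 1 = 0%R.
Proof. by apply: (addrI (tensQ_in 1)); rewrite -tensQ_inM mulg1 addr0. Qed.

Lemma tensQ_inV x : tensQ_in x^-1 = (- tensQ_in x)%R.
Proof. by apply: (addrI (tensQ_in x)); rewrite -tensQ_inM mulgV tensQ_in1 subrr. Qed.

End TensQ.

Definition finite_dimQ (V : lmodType rat) : Prop :=
  exists n (e : 'I_n -> V), forall v : V,
    exists c : 'I_n -> rat, v = (\sum_(i < n) c i *: e i)%R.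

Section LowerQCentralStep.
Variables (G : groupType) (H : normalClosed G).

(** [[H, G]] as a normal subgroup of [H]. *)
Definition commGin : {pred subgroup H} := fun u => val u \in commG H.

Lemma commG_conjg (x z : G) : x \in commG H -> x ^ z \in commG H.
Proof.
move=> xH; rewrite -(mulVKg x (x ^ z)).
have -> : x^-1 * x ^ z = [~ x, z] by [].
rewrite gpredM // mem_commG //.
move: xH => /asboolP/(_ H); apply => {}x {}z xH.
by rewrite commgEl gpredM ?gpredV // gpredJr.
Qed.

Lemma commGin_mul : mulg_closed commGin.
Proof. by move=> u v uH vH; rewrite unfold_in /commGin valM gpredM. Qed.
Lemma commGin_one : 1 \in commGin.
Proof. by rewrite unfold_in /commGin val1 gpred1. Qed.
Lemma commGin_inv : invg_closed commGin.
Proof. by move=> u uH; rewrite unfold_in /commGin gmulfV gpredV. Qed.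
Lemma commGin_conjg (u v : subgroup H) : u \in commGin -> u ^ v \in commGin.
Proof. by move=> uH; rewrite unfold_in /commGin gmulfJ commG_conjg. Qed.
HB.instance Definition _ := isMulClosed.Build _ commGin commGin_mul.
HB.instance Definition _ := isMul1Closed.Build _ commGin commGin_one.
HB.instance Definition _ := isInvClosed.Build _ commGin commGin_inv.
HB.instance Definition _ := isConjgClosed.Build _ commGin commGin_conjg.

(** The composite  H -> H / [H, G] -> (H / [H, G]) ⊗ Q. *)
Definition gammaQ_map (u : subgroup H) : tensQ (quotg commGin) :=
  tensQ_in (quotg_pi commGin u).

Definition gammaQ_step : {pred G} := fun x =>
  `[< exists u : subgroup H, val u = x /\ gammaQ_map u = 0%R >].

Lemma gammaQ_step_mul : mulg_closed gammaQ_step.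
Proof.
move=> _ _ /asboolP[u [<- u0]] /asboolP[v [<- v0]]; apply/asboolP.
exists (u * v); split; first exact: valM.
by rewrite /gammaQ_map gmulfM tensQ_inM [tensQ_in _]u0 [tensQ_in _]v0 addr0.
Qed.
Lemma gammaQ_step_one : 1 \in gammaQ_step.
Proof.
by apply/asboolP; exists 1; split; [exact: val1 | rewrite /gammaQ_map gmulf1 tensQ_in1].
Qed.
Lemma gammaQ_step_inv : invg_closed gammaQ_step.
Proof.
move=> _ /asboolP[u [<- u0]]; apply/asboolP; exists u^-1; split; first exact: gmulfV.
by rewrite /gammaQ_map gmulfV tensQ_inV [tensQ_in _]u0 oppr0.
Qed.
Lemma gammaQ_step_conjg (x y : G) : x \in gammaQ_step -> x ^ y \in gammaQ_step.
Proof.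
move=> /asboolP[u [<- u0]]; apply/asboolP.
have uyH : val u ^ y \in H by rewrite gpredJr // (valP u).
exists (Subgroup uyH); split=> //; rewrite -u0; congr tensQ_in.
apply/esym/quotg_eqP; rewrite unfold_in /commGin valM gmulfV /=.
by rewrite -commgEl mem_commG // (valP u).
Qed.
HB.instance Definition _ := isMulClosed.Build G gammaQ_step gammaQ_step_mul.
HB.instance Definition _ := isMul1Closed.Build G gammaQ_step gammaQ_step_one.
HB.instance Definition _ := isInvClosed.Build G gammaQ_step gammaQ_step_inv.
HB.instance Definition _ := isConjgClosed.Build G gammaQ_step gammaQ_step_conjg.

End LowerQCentralStep.

(** Indices start at zero: [gammaQ G i] is the (i+1)-st term of the series. *)
Fixpoint gammaQ (G : groupType) (i : nat) : normalClosed G :=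
  if i is j.+1 then gammaQ_step (gammaQ G j) else gfull G.

Fixpoint lower_central (G : groupType) (i : nat) : groupClosed G :=
  if i is j.+1 then commG (lower_central G j) else gfull G.

Definition nilpotentg (G : groupType) : Prop :=
  exists c, forall x : G, x \in lower_central G c -> x = 1.

Definition uniquely_divisible (G : groupType) : Prop :=
  forall n, (0 < n)%N -> bijective (fun x : G => x ^+ n).

(** [r] exhibits [L] as the Malcev completion N ⊗ Q of the nilpotent group [N]:
    it is the universal homomorphism from [N] to a uniquely divisible nilpotent
    group. This determines [L] and [r] up to a unique isomorphism. *)
Record is_malcev (N L : groupType) (r : {multiplicative N -> L}) : Prop :=
  IsMalcev {
    malcev_source : nilpotentg N;
    malcev_nilpotent : nilpotentg L;
    malcev_divisible : uniquely_divisible L;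
    malcev_universal : forall (H : groupType) (f : {multiplicative N -> H}),
      nilpotentg H -> uniquely_divisible H ->
      exists g : {multiplicative L -> H},
        (forall x, g (r x) = f x) /\
        forall g' : {multiplicative L -> H},
          (forall x, g' (r x) = f x) -> g' =1 g }.

(** A choice of Malcev completions of the quotients of [G] by the terms of its
    lower Q-central series, with the homomorphisms that the projections between
    these quotients induce (by [malcev_universal] they exist and are unique). *)
Record qtower (G : groupType) := QTower {
  qtower_term :> nat -> groupType;
  qtower_in : forall i, {multiplicative quotg (gammaQ G i) -> qtower_term i};
  qtower_inP : forall i, is_malcev (qtower_in i);
  qtower_proj : forall i, {multiplicative qtower_term i.+1 -> qtower_term i};
  qtower_projP : forall i (x : G),
    qtower_proj i (qtower_in i.+1 (quotg_pi _ x)) = qtower_in i (quotg_pi _ x) }.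

Section QCompletion.
Variables (G : groupType) (X : qtower G).

Definition qcompl_pred : pred (forall i, X i) := fun x =>
  `[< forall i, qtower_proj X i (x i.+1) = x i >].

Record qcompl := QCompl { qcompl_val :> forall i, X i; _ : qcompl_pred qcompl_val }.
HB.instance Definition _ := [isSub for qcompl_val].
HB.instance Definition _ := [Choice of qcompl by <:].

Lemma qcompl_eqP (x y : qcompl) : (forall i, x i = y i) -> x = y.
Proof. by move=> xy; apply/val_inj/functional_extensionality_dep. Qed.

Lemma qcompl_projP (x : qcompl) i : qtower_proj X i (x i.+1) = x i.
Proof. by have /asboolP := valP x. Qed.

Lemma qtower_proj1 i : qtower_proj X i 1 = 1.
Proof. by apply: (mulgI (qtower_proj X i 1)); rewrite -gmulfM !mulg1. Qed.

Lemma qtower_projV i x : qtower_proj X i x^-1 = (qtower_proj X i x)^-1.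
Proof.
by apply: (mulgI (qtower_proj X i x)); rewrite -gmulfM !mulgV qtower_proj1.
Qed.

Lemma qcompl_one_subproof : qcompl_pred (fun=> 1).
Proof. by apply/asboolP => i; rewrite qtower_proj1. Qed.
Lemma qcompl_mul_subproof (x y : qcompl) : qcompl_pred (fun i => x i * y i).
Proof. by apply/asboolP => i; rewrite gmulfM !qcompl_projP. Qed.
Lemma qcompl_inv_subproof (x : qcompl) : qcompl_pred (fun i => (x i)^-1).
Proof. by apply/asboolP => i; rewrite qtower_projV qcompl_projP. Qed.

Definition qcompl_one := QCompl qcompl_one_subproof.
Definition qcompl_mul x y := QCompl (qcompl_mul_subproof x y).
Definition qcompl_inv x := QCompl (qcompl_inv_subproof x).

Lemma qcompl_mulA : associative qcompl_mul.
Proof. by move=> x y z; apply: qcompl_eqP => i; exact: mulgA. Qed.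
Lemma qcompl_mul1 : left_id qcompl_one qcompl_mul.
Proof. by move=> x; apply: qcompl_eqP => i; exact: mul1g. Qed.
Lemma qcompl_mulr1 : right_id qcompl_one qcompl_mul.
Proof. by move=> x; apply: qcompl_eqP => i; exact: mulg1. Qed.
Lemma qcompl_mulV : left_inverse qcompl_one qcompl_inv qcompl_mul.
Proof. by move=> x; apply: qcompl_eqP => i; exact: mulVg. Qed.
Lemma qcompl_mulrV : right_inverse qcompl_one qcompl_inv qcompl_mul.
Proof. by move=> x; apply: qcompl_eqP => i; exact: mulgV. Qed.

HB.instance Definition _ := isGroup.Build qcompl qcompl_mulA qcompl_mul1
  qcompl_mulr1 qcompl_mulV qcompl_mulrV.

Lemma qcompl_in_subproof (x : G) :
  qcompl_pred (fun i => qtower_in X i (quotg_pi _ x)).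
Proof. by apply/asboolP => i; exact: qtower_projP. Qed.

Definition qcompl_in (x : G) : qcompl := QCompl (qcompl_in_subproof x).

Lemma qcompl_inM : {morph qcompl_in : x y / x * y}.
Proof. by move=> x y; apply: qcompl_eqP => i /=; rewrite !gmulfM. Qed.

HB.instance Definition _ := isMultiplicative.Build G qcompl qcompl_in qcompl_inM.

End QCompletion.

Section FreeLift.
Variables (R : nzRingType) (K : choiceType) (V : lmodType R) (f : K -> V).

HB.instance Definition _ := GRing.isZmodMorphism.Build {freeg K / R} V (fglift f)
  (lift_is_additive f).

Lemma fglift_is_scalable : scalable (fglift f : {freeg K / R} -> V).
Proof.
move=> a u; have -> : (a *: u = \sum_(x <- dom u) << (a * coeff x u) *g x >>)%R by [].
rewrite raddf_sum -{3}(freeg_sumE u) raddf_sum /= scaler_sumr.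
by apply: eq_bigr => x _; rewrite !liftU scalerA.
Qed.

HB.instance Definition _ := GRing.isScalable.Build R {freeg K / R} V _ (fglift f)
  fglift_is_scalable.

End FreeLift.

(** [homology G n] is H_n(G; Q) for the discrete group [G], computed from the
    inhomogeneous bar complex. *)
Section BarComplex.
Variable G : groupType.

Definition bar (n : nat) := {freeg (n.-tuple G) / rat}.
HB.instance Definition _ n := GRing.Lmodule.on (bar n).

(** With [t = (g_1, ..., g_(n+1))]: [bar_face t 0 = (g_2, ..., g_(n+1))],
    [bar_face t i = (g_1, ..., g_i * g_(i+1), ..., g_(n+1))] for [0 < i < n+1],
    and [bar_face t (n+1) = (g_1, ..., g_n)]. *)
Definition bar_face n (t : n.+1.-tuple G) (i : 'I_n.+2) : n.-tuple G :=
  [tuple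
    let a := tnth t (widen_ord (leqnSn n) j) in
    let b := tnth t (fintype.lift ord0 j) in
    if (j.+1 < i)%N then a else if j.+1 == i then a * b else b | j < n].

Definition bar_d n : bar n.+1 -> bar n :=
  fglift (fun t => (\sum_(i < n.+2) (-1) ^+ i *: << bar_face t i >>)%R).
HB.instance Definition _ n :=
  GRing.Linear.copy (@bar_d n) (fglift _).

Definition bar_cycle n : {pred bar n} :=
  match n return {pred bar n} with
  | 0 => predT
  | m.+1 => fun z => bar_d z == 0%R
  end.

Lemma bar_cycle_submod n : submod_closed (@bar_cycle n).
Proof.
case: n => [//|n]; split=> [|a u v]; rewrite !unfold_in /= ?raddf0 //.
by move=> /eqP u0 /eqP v0; rewrite linearP /= u0 v0 scaler0 addr0.
Qed.

Record barcycle n := BarCycle { cycle_val :> bar n; _ : cycle_val \in @bar_cycle n }.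
HB.instance Definition _ n := [isSub for @cycle_val n].
HB.instance Definition _ n := [Choice of barcycle n by <:].
HB.instance Definition _ n :=
  GRing.SubChoice_isSubLmodule.Build rat _ _ (barcycle n) (bar_cycle_submod n).

Definition bar_boundary n : {pred barcycle n} := fun z =>
  `[< exists w : bar n.+1, bar_d w = val z >].

Lemma bar_boundary_submod n : submod_closed (@bar_boundary n).
Proof.
split=> [|a u v /asboolP[u' du'] /asboolP[v' dv']]; apply/asboolP.
  by exists 0%R; rewrite !raddf0.
by exists (a *: u' + v')%R; rewrite !linearP /= du' dv'.
Qed.
HB.instance Definition _ n :=
  GRing.isSubmodClosed.Build rat (barcycle n) (@bar_boundary n) (bar_boundary_submod n).

Definition homology n := quotm (@bar_boundary n).
HB.instance Definition _ n := GRing.Lmodule.on (homology n).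

Definition homology_class n (z : barcycle n) : homology n := quotm_pi (@bar_boundary n) z.

End BarComplex.

Section HomologyMap.
Variables (G H : groupType) (f : {multiplicative G -> H}).

Definition bar_map n : bar G n -> bar H n :=
  fglift (fun t : n.-tuple G => << [tuple of map f t] >>)%R.
HB.instance Definition _ n :=
  GRing.Linear.copy (@bar_map n) (fglift _).

Lemma bar_face_map n (t : n.+1.-tuple G) i :
  bar_face [tuple of map f t] i = [tuple of map f (bar_face t i)].
Proof.
apply: eq_from_tnth => j; rewrite !tnth_map !tnth_ord_tuple.
by case: (ltnP j.+1 i) => // _; case: (j.+1 == i); rewrite ?gmulfM.
Qed.

Lemma bar_map_d n (z : bar G n.+1) : bar_d (bar_map z) = bar_map (bar_d z).
Proof.
rewrite -(freeg_sumE z) !raddf_sum; apply: eq_bigr => t _ /=.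
rewrite /bar_map /bar_d !liftU !linearZ /= liftU scale1r; congr (_ *: _)%R.
rewrite raddf_sum; apply: eq_bigr => i _.
by rewrite /= linearZ /= liftU scale1r bar_face_map.
Qed.

Lemma bar_map_cycle n (z : barcycle G n) : bar_map (val z) \in @bar_cycle H n.
Proof.
case: n z => [//|n] [z /= /eqP zc].
by rewrite unfold_in /= bar_map_d zc raddf0.
Qed.

Definition cycle_map n (z : barcycle G n) : barcycle H n := BarCycle (bar_map_cycle z).

Lemma cycle_map_is_linear n : linear (@cycle_map n).
Proof. by move=> a u v; apply: val_inj; rewrite /= linearP. Qed.
HB.instance Definition _ n := GRing.isLinear.Build rat (barcycle G n) (barcycle H n) _
  (@cycle_map n) (@cycle_map_is_linear n).

Definition homology_map n (x : homology G n) : homology H n :=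
  homology_class (cycle_map (repr x)).

Lemma homology_mapE n (z : barcycle G n) :
  homology_map (homology_class z) = homology_class (cycle_map z).
Proof.
apply/quotm_eqP; rewrite -raddfB; apply/asboolP.
have /asboolP[w dw] := quotm_reprP (@bar_boundary G n) z.
exists (- bar_map w)%R; rewrite raddfN /= bar_map_d dw.
by rewrite -raddfN -raddfN /= opprB.
Qed.

Lemma homology_map_is_linear n : linear (@homology_map n).
Proof.
move=> a; elim/quotW=> u; elim/quotW=> v.
by rewrite -[LHS]/(homology_map (a *: homology_class u + homology_class v)%R)
  -[RHS]/(a *: homology_map (homology_class u) + homology_map (homology_class v))%R
  !homology_mapE /homology_class -!linearP homology_mapE.
Qed.
HB.instance Definition _ n := GRing.isLinear.Build rat (homology G n)
  (homology H n) _ (@homology_map n) (@homology_map_is_linear n).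

End HomologyMap.

Record gmodule (C : groupType) (M : zmodType) := GModule {
  gact :> C -> M -> M;
  gactD : forall c, {morph gact c : x y / (x + y)%R};
  gact1 : forall x, gact 1 x = x;
  gactM : forall c d x, gact (c * d) x = gact c (gact d x) }.

Definition semidirect (C : groupType) (M : zmodType) (a : gmodule C M) : Type :=
  (M * C)%type.

Section SemidirectProduct.
Variables (C : groupType) (M : zmodType) (a : gmodule C M).

Local Notation G := (semidirect a).
HB.instance Definition _ := Choice.copy G (M * C)%type.

Definition semidirect_mul (x y : G) : G :=
  ((x.1 + a x.2 y.1)%R, x.2 * y.2).
Definition semidirect_one : G := (0%R, 1).
Definition semidirect_inv (x : G) : G := ((- a (x.2^-1)%g x.1)%R, x.2^-1).

Lemma gact0 c : a c 0%R = 0%R.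
Proof. by apply: (addrI (a c 0%R)); rewrite -gactD !addr0. Qed.
Lemma gactN c x : a c (- x)%R = (- a c x)%R.
Proof. by apply: (addrI (a c x)); rewrite -gactD !subrr gact0. Qed.

Lemma semidirect_mulA : associative semidirect_mul.
Proof. by move=> x y z; rewrite /semidirect_mul /= gactD gactM addrA mulgA. Qed.
Lemma semidirect_mul1 : left_id semidirect_one semidirect_mul.
Proof. by case=> x c; rewrite /semidirect_mul /= gact1 add0r mul1g. Qed.
Lemma semidirect_mulr1 : right_id semidirect_one semidirect_mul.
Proof. by case=> x c; rewrite /semidirect_mul /= gact0 addr0 mulg1. Qed.
Lemma semidirect_mulV : left_inverse semidirect_one semidirect_inv semidirect_mul.
Proof. by case=> x c; rewrite /semidirect_mul /= addNr mulVg. Qed.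
Lemma semidirect_mulrV : right_inverse semidirect_one semidirect_inv semidirect_mul.
Proof. by case=> x c; rewrite /semidirect_mul /= gactN -gactM mulgV gact1 subrr. Qed.

HB.instance Definition _ := isGroup.Build G semidirect_mulA semidirect_mul1
  semidirect_mulr1 semidirect_mulV semidirect_mulrV.

End SemidirectProduct.

Definition infinite_cyclic (C : groupType) : Prop :=
  exists t : C, injective (fun n => t ^+ n) /\
    forall x : C, exists n, x = t ^+ n \/ x = t ^- n.

(* Main.v *)
(** Write [V = M ⊗ Q] and let [t] generate [C]. The Fitting decomposition of [V] for
    [T = t - 1] splits off the summand [g V] on which [T] is nilpotent; the Q-completion of
    [G] only sees this summand. A [C]-stable torsion-free subgroup [L] of [M], on which [T]
    is nilpotent and which spans [g V] rationally, gives a subgroup [F = L ⋊ C] of [G].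

    Each term [X i] of the tower consists of roots of elements of the image of [F]: it
    consists of roots of images of elements of [G] by the universal property, and the
    complementary summand of [V], being [T]-divisible, dies in every torsion-free nilpotent
    quotient. For large [i] the map from [F] to [X i] is injective, as [G] maps to
    [V ⋊ Q], a uniquely divisible nilpotent group where [s] acts by the [s]-th power of
    the unipotent [1 + T g], and this map is injective on [F]. Hence [F] embeds in the
    Q-completion, which is nilpotent, and every element of the latter has a power in [F].

    Such an embedding is onto on rational homology: a cycle lives on a finitely generated
    subgroup [K], a subgroup of a finitely generated nilpotent group that contains a power
    of each generator has finite index, and for [F ∩ K] of finite index in [K] the transfer
    shows that [F ∩ K] carries the homology of [K]. *)

From HB Require Import structures.
Require Import Defs.
From mathcomp Require Import all_boot all_algebra.
From mathcomp Require Import boolp.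
From mathcomp Require Import freeg.

Set Implicit Arguments.
Unset Strict Implicit.
Unset Printing Implicit Defensive.

Import GRing.Theory Num.Theory.
Local Open Scope ring_scope.
Local Open Scope quotient_scope.
Local Open Scope group_scope.

(** * Subgroups, commutators and finite index in nilpotent groups *)

Section MulMorphisms.
Variables (G H : groupType) (f : {multiplicative G -> H}).

Lemma gmorph1 : f 1 = 1.
Proof. by apply: (mulgI (f 1)); rewrite -gmulfM !mulg1. Qed.

Lemma gmorphV x : f x^-1 = (f x)^-1.
Proof. by apply: (mulgI (f x)); rewrite -gmulfM !mulgV gmorph1. Qed.

Lemma gmorphX n x : f (x ^+ n) = f x ^+ n.
Proof. by elim: n => [|n IHn]; rewrite ?gmorph1 // !expgS gmulfM IHn. Qed.

Lemma gmorphR x y : f [~ x, y] = [~ f x, f y].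
Proof. by rewrite /commg /conjg !gmulfM !gmorphV. Qed.

Lemma gmorph_inj : (forall x, f x = 1 -> x = 1) -> injective f.
Proof.
move=> finj x y fxy; apply: divg1_eq; apply: finj.
by rewrite gmulfM gmorphV fxy mulgV.
Qed.

End MulMorphisms.

Section MulMorphism.
Variables (G H : groupType) (f : G -> H) (fM : {morph f : x y / x * y}).

Definition mulmorph : {multiplicative G -> H} :=
  HB.pack_for {multiplicative G -> H} f (isMultiplicative.Build G H f fM).

End MulMorphism.

Section SubgroupOf.
Variables (G : groupType) (P : G -> Prop).
Hypotheses (P1 : P 1) (PM : forall x y, P x -> P y -> P (x * y))
  (PV : forall x, P x -> P x^-1).

Let p : {pred G} := fun x => `[< P x >].
Let pM : mulg_closed p.
Proof. by move=> x y /asboolP px /asboolP py; apply/asboolP/PM. Qed.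
Let p1 : 1 \in p. Proof. exact/asboolP. Qed.
Let pV : invg_closed p.
Proof. by move=> x /asboolP px; apply/asboolP/PV. Qed.

Definition subgroup_of : groupClosed G :=
  HB.pack_for (groupClosed G) p
    (isMulClosed.Build G p pM) (isMul1Closed.Build G p p1) (isInvClosed.Build G p pV).

Lemma subgroup_ofP x : reflect (P x) (x \in subgroup_of).
Proof. exact: asboolP. Qed.

End SubgroupOf.

Lemma commG_ind (G : groupType) (A : {pred G}) (P : G -> Prop) :
  P 1 -> (forall x y, P x -> P y -> P (x * y)) -> (forall x, P x -> P x^-1) ->
  (forall x y, x \in A -> P [~ x, y]) -> forall z, z \in commG A -> P z.
Proof.
move=> P1 PM PV PA z /asboolP/(_ (subgroup_of P1 PM PV)) zP.
by apply/(subgroup_ofP P1 PM PV)/zP => x y xA; apply/(subgroup_ofP P1 PM PV)/PA.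
Qed.

Section LowerCentral.
Variable G : groupType.

HB.instance Definition _ (H : normalClosed G) :=
  isConjgClosed.Build G (commG H) (@commG_conjg G H).

(** The terms of [lower_central], rebuilt together with their normality so that quotients by them
    can be formed. *)
Fixpoint lcn (i : nat) : normalClosed G :=
  if i is j.+1 then commG (lcn j) else gfull G.

Lemma commG_sub (A B : {pred G}) : {subset A <= B} -> {subset commG A <= commG B}.
Proof.
move=> AB z /asboolP zA; apply/asboolP => K BK; apply: zA => x y /AB; exact: BK.
Qed.

Lemma lower_centralE i : lower_central G i =i lcn i.
Proof.
elim: i => //= i IHi x; apply/idP/idP; apply: commG_sub => {}x; by rewrite IHi.
Qed.

Lemma lcnS_sub i : {subset lcn i.+1 <= lcn i}.
Proof.
move=> x /asboolP; apply => {}x y xi.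
by rewrite commgEl gpredM ?gpredV ?gpredJr.
Qed.

Lemma lcn_commg i x y : x \in lcn i -> [~ x, y] \in lcn i.+1.
Proof. exact: mem_commG. Qed.

Lemma nilpotentP : nilpotentg G <-> exists c, forall x, x \in lcn c -> x = 1.
Proof.
by split=> -[c cP]; exists c => x xc; apply: cP;
  rewrite ?lower_centralE // -lower_centralE.
Qed.

End LowerCentral.

Lemma lcn_morph (G H : groupType) (f : {multiplicative G -> H}) i x :
  x \in lcn G i -> f x \in lcn H i.
Proof.
elim: i x => // i IHi x; apply: (commG_ind (P := fun x => f x \in lcn H i.+1)).
- by rewrite gmorph1 gpred1.
- by move=> {}x y fx fy; rewrite gmulfM gpredM.
- by move=> {}x fx; rewrite gmorphV gpredV.
- by move=> {}x y /IHi fx; rewrite gmorphR lcn_commg.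
Qed.

Lemma nilpotent_inj (G H : groupType) (f : {multiplicative G -> H}) :
  injective f -> nilpotentg H -> nilpotentg G.
Proof.
move=> finj /nilpotentP[c cP]; apply/nilpotentP; exists c => x /(lcn_morph f)/cP fx.
by apply: finj; rewrite fx gmorph1.
Qed.

Section GeneratedSubgroup.
Variables (G : groupType) (S : {pred G}).

Let in_all (z : G) := forall L : groupClosed G, {subset S <= L} -> z \in L.
Let in_all1 : in_all 1. Proof. by move=> L _; exact: gpred1. Qed.
Let in_allM x y : in_all x -> in_all y -> in_all (x * y).
Proof. by move=> xS yS L SL; rewrite gpredM ?xS ?yS. Qed.
Let in_allV x : in_all x -> in_all x^-1.
Proof. by move=> xS L SL; rewrite gpredV xS. Qed.

Definition gen : groupClosed G := subgroup_of in_all1 in_allM in_allV.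

Lemma mem_gen x : x \in S -> x \in gen.
Proof. by move=> xS; apply/(subgroup_ofP in_all1 in_allM in_allV) => L; apply. Qed.

Lemma gen_sub (L : groupClosed G) : {subset S <= L} -> {subset gen <= L}.
Proof. by move=> SL x /(subgroup_ofP in_all1 in_allM in_allV); apply. Qed.

End GeneratedSubgroup.

Lemma gen_ind (G : groupType) (S : {pred G}) (P : G -> Prop) :
  P 1 -> (forall x y, P x -> P y -> P (x * y)) -> (forall x, P x -> P x^-1) ->
  (forall x, x \in S -> P x) -> forall z, z \in gen S -> P z.
Proof.
move=> P1 PM PV PS z zS; apply/(subgroup_ofP P1 PM PV)/(gen_sub _ zS) => x xS.
exact/(subgroup_ofP P1 PM PV)/PS.
Qed.

(** * Finite index and roots in nilpotent groups *)

Definition finite_index (G : groupType) (H : {pred G}) : Prop :=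
  exists R : seq G, forall x, exists2 r, r \in R & r^-1 * x \in H.

Definition root_in (G : groupType) (H : {pred G}) (x : G) : Prop :=
  exists2 m, (0 < m)%N & x ^+ m \in H.

(** Modulo [H] the group [B] is abelian and generated by torsion elements. The induction adjoins the
    powers of one generator to the part of [H] in [B], then splits each coset of the larger subgroup
    into at most [m] cosets of [H]. *)
Lemma abelian_finite_cosets (G : groupType) (B H : groupClosed G) (ys : seq G) :
  (forall x y, x \in B -> y \in B -> [~ x, y] \in H) ->
  (forall y, y \in ys -> y \in B /\ root_in H y) ->
  (forall L : groupClosed G, (forall x, x \in B -> x \in H -> x \in L) ->
    {subset ys <= L} -> {subset B <= L}) ->
  exists R : seq G, forall x, x \in B -> exists2 r, r \in R & r^-1 * x \in H.
Proof.
elim: ys H => [|y ys IHys] H BH ysP genB.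
  exists [:: 1] => x xB; exists 1; rewrite ?inE // invg1 mul1g.
  exact: (genB H) xB.
have [yB [m m_gt0 ymH]] := ysP y (mem_head _ _).
pose P x := x \in B /\ exists a, y ^- a * x \in H.
have P1 : P 1 by split; [exact: gpred1 | exists 0%N; rewrite mulg1 invg1 gpred1].
have PM x x' : P x -> P x' -> P (x * x').
  move=> [xB [a xH]] [x'B [b x'H]]; split; first exact: gpredM.
  exists (a + b)%N; rewrite expgnDr.
  have -> : (y ^+ a * y ^+ b)^-1 * (x * x')
    = (y ^- a * x) * [~ y ^- a * x, y ^+ b] * (y ^- b * x').
    by rewrite commgEl mulVKg /conjg !invgM !mulgA !mulgK.
  apply: gpredM => //; apply: gpredM => //.
  by apply: BH; rewrite ?gpredM ?gpredV ?gpredXn.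
have PV x : P x -> P x^-1.
  move=> [xB [a xH]]; split; first by rewrite gpredV.
  (* Since [y ^+ m] lies in [H], the exponent [a * m.-1] stands in for [- a]. *)
  exists (a * m.-1)%N; set b := (a * _)%N; set w := (y ^- a * x)^-1.
  have wB : w \in B by rewrite gpredV gpredM ?gpredV ?gpredXn.
  have wH : w \in H by rewrite gpredV.
  have -> : y ^- b * x^-1 = w * [~ w, y ^+ b] * y ^- (a + b).
    have -> : x^-1 = w * y ^- a by rewrite /w invgM mulgVK.
    by rewrite commgEl mulVKg /conjg expgnDr (invgM (y ^+ a)) !mulgA mulgK.
  apply: gpredM; last first.
    rewrite gpredV /b -[X in (X + _)%N]muln1 -mulnDr add1n prednK // mulnC expgnA.
    exact: gpredXn.
  by apply: gpredM => //; apply: BH; rewrite ?gpredXn.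
pose H' := subgroup_of P1 PM PV.
have H'P x : reflect (P x) (x \in H') by exact: subgroup_ofP.
have HH' x : x \in B -> x \in H -> x \in H'.
  by move=> xB xH; apply/H'P; split=> //; exists 0%N; rewrite invg1 mul1g.
have [|z zys|L LP Lys|R RP] := IHys H'.
- by move=> x x' xB x'B; apply: HH'; [exact: gpredR | exact: BH].
- have [|zB [k k_gt0 zkH]] := ysP z; first by rewrite inE zys orbT.
  by split=> //; exists k => //; apply: HH' => //; exact: gpredXn.
- apply: genB => [x xB xH|x]; first exact/LP/HH'.
  rewrite inE => /orP[/eqP->|/Lys//]; apply: LP => //; apply/H'P; split=> //.
  by exists 1%N; rewrite expg1 mulVg gpred1.
exists [seq r * y ^+ a | r <- R, a <- iota 0 m] => x /RP[r rR /H'P[_ [a raH]]].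
exists (r * y ^+ (a %% m)); first by apply: allpairs_f => //; rewrite mem_iota ltn_mod.
suff -> : (r * y ^+ (a %% m))^-1 * x = (y ^+ m) ^+ (a %/ m) * (y ^- a * (r^-1 * x)).
  by apply: gpredM => //; exact: gpredXn.
have -> : y ^+ a = y ^+ (a %% m) * y ^+ m ^+ (a %/ m).
  by rewrite -expgnA -expgnDr addnC mulnC -divn_eq.
by rewrite !invgM -!mulgA mulVKg.
Qed.

Section MulNormal.
Variables (G : groupType) (H : groupClosed G) (N : normalClosed G).

Let P (x : G) := exists2 h, h \in H & h^-1 * x \in N.
Let P1 : P 1. Proof. by exists 1; rewrite ?mulg1 ?invg1 gpred1. Qed.
Let PM x x' : P x -> P x' -> P (x * x').
Proof.
move=> [h hH xN] [h' h'H x'N]; exists (h * h'); first exact: gpredM.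
have -> : (h * h')^-1 * (x * x') = (h^-1 * x) ^ h' * (h'^-1 * x').
  by rewrite /conjg invgM !mulgA mulgK.
by rewrite gpredM ?gpredJr.
Qed.
Let PV x : P x -> P x^-1.
Proof.
move=> [h hH xN]; exists h^-1; first by rewrite gpredV.
have -> : h^-1^-1 * x^-1 = (h^-1 * x)^-1 ^ h^-1.
  by rewrite /conjg !invgM !invgK mulgK.
by rewrite gpredJr ?gpredV.
Qed.

Definition mul_normal : groupClosed G := subgroup_of P1 PM PV.

Lemma mul_normalP x : reflect (exists2 h, h \in H & h^-1 * x \in N) (x \in mul_normal).
Proof. exact: subgroup_ofP. Qed.

Lemma mul_normal_sub x : x \in N -> x \in mul_normal.
Proof. by move=> xN; apply/mul_normalP; exists 1; rewrite ?gpred1 // invg1 mul1g. Qed.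

End MulNormal.

Lemma commgMl (G : groupType) (x y z : G) : [~ x * y, z] = [~ x, z] ^ y * [~ y, z].
Proof. by rewrite /commg /conjg !invgM !mulgA !mulgK. Qed.

Lemma commgMr (G : groupType) (x y z : G) : [~ x, y * z] = [~ x, z] * [~ x, y] ^ z.
Proof. by rewrite /commg /conjg !invgM !mulgA !mulgK. Qed.

Lemma commVgJ (G : groupType) (x y : G) : [~ x^-1, y] = ([~ x, y] ^ x^-1)^-1.
Proof. by rewrite /commg /conjg !invgM !invgK !mulgA mulgK. Qed.

Lemma commgVJ (G : groupType) (x y : G) : [~ x, y^-1] = ([~ x, y] ^ y^-1)^-1.
Proof. by rewrite /commg /conjg !invgM !invgK !mulgA mulgV mul1g. Qed.

Section NilpotentFiniteIndex.
Variables (K : groupType) (H : groupClosed K) (S : seq K).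
Hypotheses (genS : forall x, x \in gen [in S]) (rootS : {in S, forall x, root_in H x}).

Let lcn_conj i (c w : K) : c \in lcn K i -> quotg_pi (lcn K i.+1) (c ^ w) = quotg_pi (lcn K i.+1) c.
Proof.
move=> ci; apply/esym/quotg_eqP; rewrite -commgEl; exact: lcn_commg.
Qed.

Let piM i (x y : K) :
  quotg_pi (lcn K i) (x * y) = quotg_pi (lcn K i) x * quotg_pi (lcn K i) y.
Proof. exact: gmulfM. Qed.

Let lcn_conj_in (L : groupClosed K) i (c w : K) :
  {subset lcn K i.+1 <= L} -> c \in lcn K i -> c \in L -> c ^ w \in L.
Proof.
move=> subL ci cL; rewrite -(mulVKg c (c ^ w)) -commgEl.
by apply: gpredM => //; exact/subL/lcn_commg.
Qed.

Let pi_commXr i (y x : K) n : y \in lcn K i ->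
  quotg_pi (lcn K i.+2) [~ y, x ^+ n] = quotg_pi (lcn K i.+2) [~ y, x] ^+ n.
Proof.
move=> yi; elim: n => [|n IHn]; first by rewrite commg1 gmulf1.
by rewrite expgSr commgMr piM lcn_conj ?lcn_commg // IHn -expgS.
Qed.

Let pi_commXl i (y x : K) n : y \in lcn K i ->
  quotg_pi (lcn K i.+2) [~ y ^+ n, x] = quotg_pi (lcn K i.+2) [~ y, x] ^+ n.
Proof.
move=> yi; elim: n => [|n IHn]; first by rewrite comm1g gmulf1.
by rewrite expgS commgMl piM lcn_conj ?lcn_commg // IHn expgS.
Qed.

(** The commutators of weight [i + 1] in the generators generate the [i]-th
    factor of the lower central series, and by bilinearity of commutators modulo
    the next term each has a power in [H]. *)
Lemma lcn_generators i : exists Si : seq K,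
  (forall L : groupClosed K, {subset lcn K i.+1 <= L} -> {subset Si <= L} ->
    {subset lcn K i <= L}) /\
  (forall y, y \in Si -> y \in lcn K i /\ root_in (mul_normal H (lcn K i.+1)) y).
Proof.
elim: i => [|i [Si [genSi rootSi]]].
  exists S; split=> [L _ SL x _|y /rootS[m m_gt0 ymH]]; first exact: gen_sub (genS x).
  split=> //; exists m => //; apply/mul_normalP; exists (y ^+ m) => //.
  by rewrite mulVg gpred1.
exists [seq [~ y, x] | y <- Si, x <- S]; split=> [L subL SL|_ /allpairsP[[y x]] /= [ySi xS ->]].
  have lcnJ c w : c \in lcn K i.+1 -> c \in L -> c ^ w \in L by exact: lcn_conj_in.
  (* Bilinearity enters as closure: the [u] whose commutators with everything lie in [L] form a
     subgroup, conjugation being harmless modulo [lcn K i.+2]. *)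
  pose P u := u \in lcn K i /\ forall x, [~ u, x] \in L.
  have P1 : P 1 by split=> [|x]; rewrite ?comm1g gpred1.
  have PM u v : P u -> P v -> P (u * v).
    move=> [ui uL] [vi vL]; split=> [|x]; first exact: gpredM.
    by rewrite commgMl gpredM ?lcnJ ?lcn_commg.
  have PV u : P u -> P u^-1.
    move=> [ui uL]; split=> [|x]; first by rewrite gpredV.
    by rewrite commVgJ gpredV lcnJ ?lcn_commg.
  pose L' := subgroup_of P1 PM PV.
  have L'P u : reflect (P u) (u \in L') by exact: subgroup_ofP.
  have PL u : u \in lcn K i -> P u.
    move=> ui; apply/L'P; apply: (genSi L') ui => {}u.
      move=> ui; apply/L'P; split=> [|x]; first exact: lcnS_sub.
      exact/subL/lcn_commg.
    move=> uSi; have [ui _] := rootSi u uSi; apply/L'P; split=> // x.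
    move: x (genS x); apply: gen_ind => [|x x' xL x'L|x xL|x xS].
    - by rewrite commg1 gpred1.
    - by rewrite commgMr gpredM ?lcnJ ?lcn_commg.
    - by rewrite commgVJ gpredV lcnJ ?lcn_commg.
    - by apply: SL; apply: allpairs_f.
  move=> z; apply: (commG_ind (P := fun z => z \in L)).
  - exact: gpred1.
  - by move=> x y xL yL; exact: gpredM.
  - by move=> x xL; rewrite gpredV.
  - by move=> u x /PL[_].
have [yi [m m_gt0 /mul_normalP[h hH hy]]] := rootSi y ySi.
have [n n_gt0 xnH] := rootS xS.
split; first exact: lcn_commg.
exists (m * n)%N; first by rewrite muln_gt0 m_gt0.
(* As [h] and [y ^+ m] agree modulo [lcn K i.+1], this commutator agrees modulo [lcn K i.+2] with
   [[~ y ^+ m, x ^+ n]], the power [m * n] of [[~ y, x]]. *)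
apply/mul_normalP; exists [~ h, x ^+ n].
  exact: gpredR.
have hi : h \in lcn K i.
  have -> : h = y ^+ m * (h^-1 * y ^+ m)^-1 by rewrite invgM invgK mulVKg.
  by rewrite gpredM ?gpredV ?gpredXn //; exact: lcnS_sub.
apply/quotg_eqP; rewrite -[LHS]/(quotg_pi _ _) -[RHS]/(quotg_pi _ _).
have -> : quotg_pi (lcn K i.+2) ([~ y, x] ^+ (m * n)) = quotg_pi _ [~ y ^+ m, x ^+ n].
  by rewrite pi_commXr ?gpredXn // pi_commXl // expgnA !gmorphX.
rewrite -[y ^+ m](mulVKg h) commgMl piM lcn_conj ?lcn_commg // -[LHS]mulg1.
congr (_ * _); apply/quotg_eqP; rewrite invg1 mul1g; exact: mem_commG.
Qed.

(** The product of [H] and [lcn K i] has finite index for every [i]: passing to [i.+1] costs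
    finitely many cosets in the abelian factor of the series. Once [lcn K c] is trivial, the product
    is [H] itself. *)
Theorem nilpotent_finite_index : nilpotentg K -> finite_index H.
Proof.
move=> /nilpotentP[c cP]; have: finite_index (mul_normal H (lcn K c)).
  elim: c {cP} => [|i [R RP]].
    by exists [:: 1] => x; exists 1; rewrite ?inE // mul_normal_sub.
  have [Si [genSi rootSi]] := lcn_generators i.
  have [|||R' R'P] := @abelian_finite_cosets K (lcn K i) (mul_normal H (lcn K i.+1)) Si.
  - by move=> x y xi yi; apply/mul_normal_sub/lcn_commg.
  - exact: rootSi.
  - move=> L LP; apply: genSi => x xi; apply: LP; first exact: lcnS_sub.
    exact: mul_normal_sub.
  exists [seq r * r' | r <- R, r' <- R'] => x.
  have [r rR /mul_normalP[h hH hz]] := RP x.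
  (* Here [x = r * h * z] with [z] in [lcn K i]; conjugating [z] by [h^-1] moves [h] to the right of
     it. *)
  have [|r' r'R' zH] := R'P ((h^-1 * (r^-1 * x)) ^ h^-1); first exact: gpredJr.
  exists (r * r'); first exact: allpairs_f.
  have -> : (r * r')^-1 * x = r'^-1 * (h^-1 * (r^-1 * x)) ^ h^-1 * h.
    by rewrite /conjg invgK !invgM !mulgA mulgVK mulgK.
  apply: gpredM => //; apply/mul_normalP; exists h => //.
  by rewrite mulVg gpred1.
move=> [R RP]; exists R => x; have [r rR /mul_normalP[h hH /cP hz]] := RP x.
exists r => //; suff -> : r^-1 * x = h by [].
by rewrite -[LHS](mulVKg h) hz mulg1.
Qed.

End NilpotentFiniteIndex.

(** Pigeonhole: among [x ^+ 0], ..., [x ^+ size R] two powers share a coset. *)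
Lemma finite_index_root (G : groupType) (A : groupClosed G) x :
  finite_index A -> root_in A x.
Proof.
move=> [R RP].
have /choice[f fP] : forall i, exists r, r \in R /\ r^-1 * x ^+ i \in A.
  by move=> i; have [r] := RP (x ^+ i); exists r.
have : ~~ uniq [seq f i | i <- iota 0 (size R).+1].
  apply/negP => funiq.
  have /(uniq_leq_size funiq) : {subset [seq f i | i <- iota 0 (size R).+1] <= R}.
    by move=> r /mapP[i _ ->]; case: (fP i).
  by rewrite size_map size_iota ltnn.
move/(uniqPn 1) => [i [j [ij jR]]]; rewrite size_map size_iota in jR.
rewrite !(nth_map 0%N) ?size_iota ?(ltn_trans ij) // !nth_iota ?(ltn_trans ij) //.
rewrite !add0n => fij; exists (j - i)%N; first by rewrite subn_gt0.
have -> : x ^+ (j - i) = ((f i)^-1 * x ^+ i)^-1 * ((f j)^-1 * x ^+ j).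
  by rewrite -fij invgM invgK -mulgA mulVKg -[in RHS](subnKC (ltnW ij)) expgnDr mulKg.
by apply: gpredM; rewrite ?gpredV; [case: (fP i)|case: (fP j)].
Qed.

Section SubgroupVal.
Variables (G : groupType) (K : groupClosed G).

Definition sgval_morph : {multiplicative subgroup K -> G} := mulmorph (valM (H := subgroup K)).

Lemma sgval_morph_inj : injective sgval_morph. Proof. exact: val_inj. Qed.

Lemma nilpotent_subgroup : nilpotentg G -> nilpotentg (subgroup K).
Proof. exact: nilpotent_inj sgval_morph_inj. Qed.

End SubgroupVal.

Lemma gen_subgroup (G : groupType) (S : seq G) :
  exists2 S' : seq (subgroup (gen [in S])), forall u, u \in gen [in S']
    & {in S', forall u, val u \in S}.
Proof.
pose K := gen [in S]; pose S' : seq (subgroup K) := pmap insub S.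
exists S' => [u|u]; last by rewrite mem_pmap_sub.
suff: forall z, z \in gen [in S] -> exists2 u' : subgroup K, val u' = z & u' \in gen [in S'].
  by move=> /(_ (val u) (valP u))[u' /val_inj->].
apply: gen_ind => [|x y [u' <- u'S] [v' <- v'S]|x [u' <- u'S]|x xS].
- by exists 1; rewrite ?val1 ?gpred1.
- by exists (u' * v'); rewrite ?valM ?gpredM.
- by exists u'^-1; rewrite ?gmulfV ?gpredV.
- have xK : x \in K by exact: mem_gen.
  exists (Subgroup xK) => //; apply: mem_gen; suff: Subgroup xK \in S' by [].
  by rewrite mem_pmap_sub.
Qed.

Section Preimage.
Variables (K G : groupType) (f : {multiplicative K -> G}) (H : groupClosed G).

Let P x := f x \in H.
Let P1 : P 1. Proof. by rewrite /P gmorph1 gpred1. Qed.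
Let PM x y : P x -> P y -> P (x * y).
Proof. by rewrite /P gmulfM; exact: gpredM. Qed.
Let PV x : P x -> P x^-1. Proof. by rewrite /P gmorphV gpredV. Qed.

Definition preim_closed : groupClosed K := subgroup_of P1 PM PV.

Lemma mem_preim x : (x \in preim_closed) = (f x \in H).
Proof. exact/subgroup_ofP/idP. Qed.

End Preimage.

Section RootClosure.
Variables (G : groupType) (H : groupClosed G) (nilG : nilpotentg G).

Lemma gen_finite_index (S : seq G) : {in S, forall x, root_in H x} ->
  finite_index (preim_closed (sgval_morph (gen [in S])) H).
Proof.
move=> rootS; have [S' genS' S'S] := gen_subgroup S.
apply: (@nilpotent_finite_index _ _ S') => [//|u|]; last exact: nilpotent_subgroup.
move=> /S'S/rootS[m m_gt0 umH].
by exists m => //; rewrite mem_preim gmorphX.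
Qed.

Let P x := root_in H x.
Let P1 : P 1. Proof. by exists 1%N => //; exact: gpred1. Qed.
Let PV x : P x -> P x^-1.
Proof. by move=> [m m_gt0 xmH]; exists m; rewrite // expVgn gpredV. Qed.
(** [H] meets the subgroup generated by [x] and [y] in finite index, so [finite_index_root] applies
    to [x * y]. *)
Let PM x y : P x -> P y -> P (x * y).
Proof.
move=> xH yH; have /(@gen_finite_index [:: x; y]) : {in [:: x; y], forall z, root_in H z}.
  by move=> z; rewrite !inE => /orP[] /eqP->.
have xyS : x * y \in gen [in [:: x; y]] by rewrite gpredM ?mem_gen ?inE ?eqxx ?orbT.
move/finite_index_root => /(_ (Subgroup xyS))[m m_gt0].
by rewrite mem_preim gmorphX => xyH; exists m.
Qed.

Definition root_closure : groupClosed G := subgroup_of P1 PM PV.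

Lemma root_closureP x : reflect (root_in H x) (x \in root_closure).
Proof. exact: subgroup_ofP. Qed.

End RootClosure.

(** * Transfer in the bar complex *)

Lemma freegUZ (K : choiceType) (k : rat) (x : K) : (<< k *g x >> = k *: << x >>)%R.
Proof. by apply/eqP/freeg_eqP => y; rewrite coeffZ !coeffU mul1r. Qed.

Section FreeModule.
Variables (K : choiceType) (V : lmodType rat).

Lemma fgliftE (f : K -> V) x : fglift f << x >>%R = f x.
Proof. by rewrite liftU scale1r. Qed.

Lemma freeg_linear_ext (f g : {linear {freeg K / rat} -> V}) :
  (forall x, f << x >>%R = g << x >>%R) -> f =1 g.
Proof.
move=> fg z; rewrite -(freeg_sumE z) !raddf_sum; apply: eq_bigr => x _ /=.
by rewrite freegUZ !linearZ /= fg.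
Qed.

End FreeModule.

(** Homogeneous simplices are sequences; the empty one spans degree [-1], which lets
    [seq_bd] and [prism] be defined by recursion through the cone operator and makes
    [prism_homotopy] hold in every degree. *)
Section SeqComplex.
Variable G : choiceType.
Local Notation C := {freeg (seq G) / rat}.

Definition cone (x : G) : C -> C := fglift (fun s => << x :: s >>%R).
HB.instance Definition _ x := GRing.Linear.copy (cone x) (fglift _).

Fixpoint seq_bd1 (s : seq G) : C :=
  if s is x :: s' then (<< s' >> - cone x (seq_bd1 s'))%R else 0%R.

Definition seq_bd : C -> C := fglift seq_bd1.
HB.instance Definition _ := GRing.Linear.copy seq_bd (fglift _).

(** Unfolds to the alternating sum of the [(f x_0, ..., f x_i, x_i, ..., x_n)], the standard
    homotopy between the identity and [f]. *)
Fixpoint prism1 (f : G -> G) (s : seq G) : C :=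
  if s is x :: s' then (<< [:: f x, x & s'] >> - cone (f x) (prism1 f s'))%R else 0%R.

Definition prism f : C -> C := fglift (prism1 f).
HB.instance Definition _ f := GRing.Linear.copy (prism f) (fglift _).

Lemma coneE x s : cone x << s >>%R = << x :: s >>%R. Proof. exact: fgliftE. Qed.
Lemma seq_bdE s : seq_bd << s >>%R = seq_bd1 s. Proof. exact: fgliftE. Qed.
Lemma prismE f s : prism f << s >>%R = prism1 f s. Proof. exact: fgliftE. Qed.

(** The cone is a contracting homotopy of the augmented complex. *)
Lemma seq_bd_cone x c : seq_bd (cone x c) = (c - cone x (seq_bd c))%R.
Proof.
have -> : (c - cone x (seq_bd c) = (idfun \- (cone x \o seq_bd)) c)%R by [].
have -> : seq_bd (cone x c) = (seq_bd \o cone x) c by [].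
by apply: freeg_linear_ext => s; rewrite /= coneE !seq_bdE.
Qed.

Lemma prism_cone f x c :
  prism f (cone x c) = (cone (f x) (cone x c) - cone (f x) (prism f c))%R.
Proof.
have -> : (cone (f x) (cone x c) - cone (f x) (prism f c) =
  ((cone (f x) \o cone x) \- (cone (f x) \o prism f)) c)%R by [].
have -> : prism f (cone x c) = (prism f \o cone x) c by [].
by apply: freeg_linear_ext => s; rewrite /= !coneE !prismE.
Qed.

End SeqComplex.

Section SeqMap.
Variables (G H : choiceType) (f : G -> H).

Definition seq_map : {freeg (seq G) / rat} -> {freeg (seq H) / rat} :=
  fglift (fun s => << map f s >>%R).
HB.instance Definition _ := GRing.Linear.copy seq_map (fglift _).

Lemma seq_mapE s : seq_map << s >>%R = << map f s >>%R. Proof. exact: fgliftE. Qed.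

Lemma seq_map_cone x c : seq_map (cone x c) = cone (f x) (seq_map c).
Proof.
have -> : seq_map (cone x c) = (seq_map \o cone x) c by [].
have -> : cone (f x) (seq_map c) = (cone (f x) \o seq_map) c by [].
by apply: freeg_linear_ext => s; rewrite /= coneE !seq_mapE coneE.
Qed.

Lemma seq_map_bd c : seq_bd (seq_map c) = seq_map (seq_bd c).
Proof.
have -> : seq_bd (seq_map c) = (@seq_bd H \o seq_map) c by [].
have -> : seq_map (seq_bd c) = (seq_map \o @seq_bd G) c by [].
apply: freeg_linear_ext => s; rewrite /= seq_mapE !seq_bdE.
elim: s => [|x s IHs] /=; first by rewrite raddf0.
by rewrite raddfB /= seq_mapE seq_map_cone IHs.
Qed.

End SeqMap.

Lemma seq_map_comp (G H K : choiceType) (f : G -> H) (g : H -> K) c :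
  seq_map (g \o f) c = seq_map g (seq_map f c).
Proof.
rewrite -[RHS]/((seq_map g \o seq_map f) c).
by apply: freeg_linear_ext => s; rewrite /= !seq_mapE map_comp.
Qed.

Lemma prism_homotopy (G : choiceType) (f : G -> G) c :
  (seq_bd (prism f c) + prism f (seq_bd c) = c - seq_map f c)%R.
Proof.
have -> : (seq_bd (prism f c) + prism f (seq_bd c) =
  ((@seq_bd G \o prism f) \+ (prism f \o @seq_bd G)) c)%R by [].
have -> : (c - seq_map f c = (idfun \- seq_map f) c)%R by [].
apply: freeg_linear_ext => s; rewrite /= prismE seq_bdE seq_mapE.
elim: s => [|x s IHs] /=; first by rewrite !raddf0 addr0 subrr.
rewrite !raddfB /= prismE seq_bdE /= prism_cone seq_bd_cone !raddfB /= -[in RHS](coneE (f x)).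
have -> : (<< map f s >> = << s >> - (seq_bd (prism1 f s) + prism f (seq_bd1 s)))%R.
  by rewrite IHs subKr.
rewrite raddfB raddfD /= ?opprB ?opprD ?opprB ?opprD ?opprK !addrA.
rewrite [LHS](ACl (1*2*5*8*(3*7)*(4*6))%AC) /= subrr addNr !addr0.
by rewrite raddfD /= !addrA.
Qed.

Lemma seq_bd1E (G : choiceType) (s : seq G) :
  seq_bd1 s = (\sum_(i < size s) (-1) ^+ i *: << take i s ++ drop i.+1 s >>)%R.
Proof.
elim: s => [|x s IHs]; first by rewrite big_ord0.
rewrite /= IHs big_ord_recl expr0 scale1r /= drop0 raddf_sum -sumrN; congr (_ + _)%R.
by apply: eq_bigr => i _; rewrite /= linearZ /= coneE exprS mulN1r scaleNr.
Qed.

(** * Homogeneous simplices and bar coordinates *)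

Section Simplices.
Variable G : groupType.
Local Notation C := {freeg (seq G) / rat}.

(** Bar coordinates of a homogeneous simplex; [partial_products] goes back, choosing in each
    translation orbit the simplex with first vertex 1. *)
Definition quotients (s : seq G) : seq G := pairmap (fun x y => x^-1 * y) (head 1 s) (behead s).

Definition partial_products (t : seq G) : seq G := 1 :: scanl *%g 1 t.

Lemma size_quotients s : size (quotients s) = (size s).-1.
Proof. by rewrite size_pairmap size_behead. Qed.

Lemma nth_quotients s i : (i.+1 < size s)%N ->
  nth 1 (quotients s) i = (nth 1 s i)^-1 * nth 1 s i.+1.
Proof. by case: s => [|x s] //= i_lt; rewrite /quotients (nth_pairmap 1). Qed.

Lemma quotientsK t : quotients (partial_products t) = t.
Proof. by rewrite /quotients /=; apply: scanlK => x y; rewrite mulKg. Qed.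

Lemma partial_productsK x s :
  map ( *%g x) (partial_products (quotients (x :: s))) = x :: s.
Proof.
rewrite /partial_products /quotients /= mulg1; congr (_ :: _).
have -> : forall t, map ( *%g x) (scanl *%g 1 t) = scanl *%g x t.
  move=> t; rewrite -[in RHS](mulg1 x); elim: t (1 : G) => //= y t IHt z.
  by rewrite mulgA IHt mulgA.
by apply: pairmapK => y z; rewrite mulVKg.
Qed.

Lemma quotients_translate k s : quotients (map ( *%g k) s) = quotients s.
Proof.
apply: (@eq_from_nth _ 1); rewrite !size_quotients size_map // => i.
rewrite ltn_predRL => i_lt; rewrite !nth_quotients ?size_map //.
rewrite !(nth_map 1) ?(ltnW i_lt) //.
by rewrite invgM -mulgA mulKg.
Qed.

(** Omitting an inner vertex multiplies the two adjacent quotients; omitting an extreme vertex drops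
    one. *)
Lemma quotients_face n (s : seq G) (t : n.+1.-tuple G) (i : 'I_n.+2) :
  quotients s = t -> size s = n.+2 ->
  quotients (take i s ++ drop i.+1 s) = bar_face t i.
Proof.
move=> st sz; set s' := take i s ++ drop i.+1 s.
have sz' : size s' = n.+1.
  by rewrite size_cat size_take size_drop sz ltn_ord subSS subnKC // leq_ord.
have s'E j : nth 1 s' j = nth 1 s (if (j < i)%N then j else j.+1).
  rewrite nth_cat size_take sz ltn_ord.
  case: ltnP => ji; first by rewrite nth_take.
  by rewrite nth_drop addSn subnKC.
have tE (j : 'I_n.+1) : tnth t j = (nth 1 s j)^-1 * nth 1 s j.+1.
  by rewrite (tnth_nth 1) -st nth_quotients // sz ltnS ltn_ord.
apply: (@eq_from_nth _ 1); rewrite size_quotients sz' ?size_tuple // => j j_lt.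
rewrite nth_quotients ?sz' // !s'E.
rewrite -[j]/(val (Ordinal j_lt)) -tnth_nth tnth_mktuple /= !tE /=.
rewrite /bump leq0n add1n; case: (ltngtP j.+1 i) => // _.
by rewrite -mulgA mulVKg.
Qed.

(** The empty simplex is treated apart: its quotients form the empty sequence, which would otherwise
    count as a bar simplex of degree 0. *)
Definition simplex n (s : seq G) : bar G n :=
  if s isn't [::] then oapp (fun t : n.-tuple G => << t >>)%R 0%R (insub (quotients s)) else 0%R.

Definition to_bar n : C -> bar G n := fglift (simplex n).
HB.instance Definition _ n := GRing.Linear.copy (to_bar n) (fglift _).

Definition of_bar n : bar G n -> C := fglift (fun t : n.-tuple G => << partial_products t >>)%R.
HB.instance Definition _ n := GRing.Linear.copy (@of_bar n) (fglift _).

Lemma to_barE n s : to_bar n << s >>%R = simplex n s. Proof. exact: fgliftE. Qed.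
Lemma of_barE n (t : n.-tuple G) : @of_bar n << t >>%R = << partial_products t >>%R.
Proof. exact: fgliftE. Qed.

Lemma simplexE n s (t : n.-tuple G) : s != [::] -> quotients s = t -> simplex n s = << t >>%R.
Proof. by case: s => // x s _; rewrite /simplex => ->; rewrite valK. Qed.

Lemma simplex_neq n s : size s != n.+1 -> simplex n s = 0%R.
Proof.
case: s => // x s sz; rewrite /simplex insubN //.
by rewrite size_quotients.
Qed.

Lemma of_barK n z : to_bar n (of_bar z) = z.
Proof.
rewrite -[LHS]/((to_bar n \o @of_bar n) z) -[RHS]/(idfun z).
apply: freeg_linear_ext => t; rewrite /= of_barE to_barE.
by apply: simplexE; rewrite ?quotientsK.
Qed.

Lemma to_bar_bd n c : to_bar n (seq_bd c) = bar_d (to_bar n.+1 c).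
Proof.
rewrite -[LHS]/((to_bar n \o @seq_bd G) c) -[RHS]/((@bar_d G n \o to_bar n.+1) c).
apply: freeg_linear_ext => s; rewrite /= seq_bdE to_barE seq_bd1E raddf_sum /=.
have [sz|sz] := eqVneq (size s) n.+2; last first.
  rewrite simplex_neq // raddf0; apply: big1 => i _.
  rewrite linearZ /= to_barE simplex_neq ?scaler0 //.
  rewrite size_cat size_take size_drop ltn_ord.
  have sizeE a b : (a < b)%N -> (a + (b - a.+1) = b.-1)%N.
    by case: b => // b ab; rewrite subSS subnKC.
  by rewrite sizeE ?ltn_ord //; move: sz; clear; case: (size s).
have s0 : s != [::] by case: (s) sz.
have tP : size (quotients s) == n.+1 by rewrite size_quotients sz.
rewrite (@simplexE n.+1 s (Tuple tP)) // /bar_d fgliftE sz.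
apply: eq_bigr => i _; rewrite linearZ /= to_barE; congr (_ *: _)%R.
apply: simplexE; last exact: quotients_face.
rewrite -size_eq0 size_cat size_take size_drop sz ltn_ord.
by case: i => -[|i] i_lt //=; rewrite subSS.
Qed.

Lemma to_bar_translate n k c : to_bar n (seq_map ( *%g k) c) = to_bar n c.
Proof.
rewrite -[LHS]/((to_bar n \o seq_map ( *%g k)) c).
apply: freeg_linear_ext => s; rewrite /= seq_mapE !to_barE.
by case: s => // x s; rewrite /simplex quotients_translate.
Qed.

(** In a translation invariant quotient, only the bar coordinates of a homogeneous
    simplex matter, so [of_bar] becomes a chain map. *)
Lemma translation_invariant_bd (V : lmodType rat) (f : {linear C -> V}) n (z : bar G n.+1) :
  (forall k s, f << map ( *%g k) s >>%R = f << s >>%R) ->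
  f (seq_bd (of_bar z)) = f (of_bar (bar_d z)).
Proof.
move=> finv.
rewrite -[LHS]/((f \o (@seq_bd G \o @of_bar n.+1)) z) -[RHS]/((f \o (@of_bar n \o @bar_d G n)) z).
apply: freeg_linear_ext => t.
have sz : size (partial_products t) = n.+2 by rewrite /= size_scanl size_tuple.
rewrite [LHS]/= of_barE seq_bdE; move: (partial_products t) (quotientsK t) sz => p pt sz.
rewrite /= /bar_d fgliftE seq_bd1E !raddf_sum /=.
rewrite sz; apply: eq_bigr => i _; rewrite !linearZ /= of_barE; congr (_ *: _)%R.
rewrite -(quotients_face i pt sz).
set s := _ ++ _; have : s != [::].
  rewrite -size_eq0 size_cat size_take size_drop sz ltn_ord.
  by case: i {s} => -[|i] i_lt //=; rewrite subSS.
by case: s => // x s _; rewrite -[in LHS](partial_productsK x s) finv.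
Qed.

End Simplices.

Lemma to_bar_map (G H : groupType) (f : {multiplicative G -> H}) n c :
  to_bar n (seq_map f c) = bar_map f (to_bar n c).
Proof.
rewrite -[LHS]/((to_bar n \o seq_map f) c) -[RHS]/((@bar_map _ _ f n \o to_bar n) c).
apply: freeg_linear_ext => s; rewrite /= seq_mapE !to_barE.
have [->|s0] := eqVneq s [::]; first by rewrite raddf0.
have [sz|sz] := eqVneq (size s) n.+1; last by rewrite !simplex_neq ?size_map // raddf0.
have tP : size (quotients s) == n by rewrite size_quotients sz.
rewrite (@simplexE _ n s (Tuple tP)) // /bar_map fgliftE; apply: simplexE; first by case: (s) s0.
apply: (@eq_from_nth _ 1) => [|i]; rewrite size_quotients ?size_map ?size_quotients // => i_lt.
rewrite /= (nth_map 1) ?size_quotients // !nth_quotients ?size_map ?sz; rewrite sz in i_lt => //.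
rewrite !(nth_map 1) ?sz //; last exact: ltnW.
by rewrite gmulfM gmorphV.
Qed.

Lemma prism_equivariant (G : groupType) (g : G -> G) (k : G) s :
  (forall x, g (k * x) = k * g x) ->
  prism1 g (map ( *%g k) s) = seq_map ( *%g k) (prism1 g s).
Proof.
move=> gk; elim: s => [|x s IHs] /=; first by rewrite raddf0.
by rewrite raddfB /= seq_mapE /= seq_map_cone gk IHs.
Qed.

(** [al (f x)] is the subgroup component of [x = al (f x) * r], where [r] is the
    representative in [R] of the right coset of [x]. *)
Section Transfer.
Variables (H K : groupType) (al : {multiplicative H -> K}) (f : K -> H) (R : seq K).
Hypotheses (f_equiv : forall h x, f (al h * x) = h * f x).
Hypotheses (R_repr : forall x, (al (f x))^-1 * x \in R).
Hypotheses (f_repr : forall r, r \in R -> f r = 1).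
Hypothesis (uniqR : uniq R).

(** Right multiplication by [k] permutes the cosets: [sg r] is the representative of the coset of
    [r * k], and [F] takes the same value at both. *)
Lemma sum_cosets (V : lmodType rat) (F : K -> V) k : (forall h x, F (al h * x) = F x) ->
  (\sum_(r <- R) F (r * k)%g = \sum_(r <- R) F r)%R.
Proof.
move=> Finv; pose sg r := (al (f (r * k)))^-1 * (r * k).
have sg_inj : {in R &, injective sg}.
  move=> r1 r2 r1R r2R sg12.
  have r1E : r1 = al (f (r1 * k) * (f (r2 * k))^-1) * r2.
    apply: (mulIg k); rewrite gmulfM gmorphV -!mulgA -[_ * (r2 * k)]/(sg r2) -sg12.
    by rewrite mulVKg.
  have := f_equiv (f (r1 * k) * (f (r2 * k))^-1) r2.
  by rewrite -r1E (f_repr r1R) (f_repr r2R) mulg1 => hE; rewrite r1E -hE gmorph1 mul1g.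
have sg_perm : perm_eq (map sg R) R.
  have sgR : uniq (map sg R) by rewrite map_inj_in_uniq.
  have sgRR : {subset map sg R <= R} by move=> _ /mapP[r _ ->]; exact: R_repr.
  apply: uniq_perm => //; have [|_ //] := uniq_min_size sgR sgRR.
  by rewrite size_map.
rewrite -[RHS](perm_big _ sg_perm) big_map; apply: eq_bigr => r _.
by rewrite /sg -gmorphV Finv.
Qed.

Definition trans_sum (V : lmodType rat) (F : {freeg (seq K) / rat} -> V) c : V :=
  (\sum_(r <- R) F (seq_map ( *%g r) c))%R.

Lemma trans_sum_is_linear (V : lmodType rat) (F : {linear {freeg (seq K) / rat} -> V}) :
  linear (trans_sum F).
Proof.
move=> a u v; rewrite /trans_sum scaler_sumr -big_split; apply: eq_bigr => r _.
by rewrite !linearP.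
Qed.

HB.instance Definition _ (V : lmodType rat) (F : {linear {freeg (seq K) / rat} -> V}) :=
  GRing.isLinear.Build rat _ V _ (trans_sum F) (trans_sum_is_linear F).

(** Summing over coset representatives improves invariance under the image of [H] to invariance
    under all of [K]. *)
Lemma trans_sum_inv (V : lmodType rat) (F : {linear {freeg (seq K) / rat} -> V}) k s :
  (forall h s', F << map ( *%g (al h)) s' >>%R = F << s' >>%R) ->
  trans_sum F << map ( *%g k) s >>%R = trans_sum F << s >>%R.
Proof.
move=> Finv; rewrite /trans_sum.
rewrite -[RHS](sum_cosets (F := fun r => F (seq_map ( *%g r) << s >>%R)) k).
  apply: eq_bigr => r _; rewrite !seq_mapE -map_comp; congr (F << _ >>)%R.
  by apply: eq_map => x /=; rewrite mulgA.
move=> h x; rewrite !seq_mapE -[RHS](Finv h) -map_comp; congr (F << _ >>)%R.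
by apply: eq_map => y /=; rewrite mulgA.
Qed.

Definition transfer n : {freeg (seq K) / rat} -> bar H n :=
  trans_sum (to_bar n \o seq_map f).
HB.instance Definition _ n := GRing.Linear.copy (transfer n) (trans_sum _).

Definition transfer_homotopy n : {freeg (seq K) / rat} -> bar K n :=
  trans_sum (to_bar n \o prism (al \o f)).
HB.instance Definition _ n := GRing.Linear.copy (transfer_homotopy n) (trans_sum _).

Lemma transfer_translate n k s : transfer n << map ( *%g k) s >>%R = transfer n << s >>%R.
Proof.
apply: trans_sum_inv => h s' /=; rewrite !seq_mapE -[RHS](to_bar_translate n h) seq_mapE.
by rewrite -!map_comp; congr (to_bar _ << _ >>)%R; apply: eq_map => x /=.
Qed.

Lemma transfer_homotopy_translate n k s :
  transfer_homotopy n << map ( *%g k) s >>%R = transfer_homotopy n << s >>%R.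
Proof.
apply: trans_sum_inv => h s' /=.
rewrite !prismE prism_equivariant ?to_bar_translate // => x /=.
by rewrite f_equiv gmulfM.
Qed.

(** Transfer followed by [al] is homotopic to multiplication by the index: every [r] contributes one
    prism homotopy between the identity and [al \o f], and translation by [r] leaves bar coordinates
    unchanged. *)
Lemma transfer_homotopyP n c :
  (bar_d (transfer_homotopy n.+1 c) + transfer_homotopy n (seq_bd c) =
   to_bar n c *+ size R - bar_map al (transfer n c))%R.
Proof.
rewrite /transfer_homotopy /transfer /trans_sum !raddf_sum.
have -> : (to_bar n c *+ size R = \sum_(r <- R) to_bar n c)%R.
  by rewrite big_const_seq count_predT iter_addr addr0.
rewrite -!big_split; apply: eq_bigr => r _ /=.
rewrite -to_bar_map -seq_map_comp -(to_bar_translate n r c) -seq_map_bd -to_bar_bd.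
by rewrite -raddfD -raddfB prism_homotopy.
Qed.

Lemma transfer_bd n c : bar_d (transfer n.+1 c) = transfer n (seq_bd c).
Proof.
rewrite /transfer /trans_sum !raddf_sum; apply: eq_bigr => r _ /=.
by rewrite -to_bar_bd -!seq_map_bd.
Qed.

Lemma transfer_surjective n (z : bar K n.+1) : bar_d z = 0%R -> (0 < size R)%N ->
  exists2 w : bar H n.+1, bar_d w = 0%R & exists v, (bar_d v = z - bar_map al w)%R.
Proof.
move=> dz R_gt0; set N := (size R)%:R%R : rat.
have N0 : (N != 0)%R by rewrite pnatr_eq0 -lt0n.
have tr0 : bar_d (transfer n.+1 (of_bar z)) = 0%R.
  by rewrite transfer_bd (translation_invariant_bd z (@transfer_translate n)) dz !raddf0.
exists (N^-1 *: transfer n.+1 (of_bar z))%R.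
  by rewrite linearZ /= tr0 scaler0.
exists (N^-1 *: transfer_homotopy n.+2 (of_bar z))%R.
have := transfer_homotopyP n.+1 (of_bar z).
(* Translation invariance lets [of_bar] pass the differential, so the second homotopy term vanishes
   on the cycle [z]. *)
rewrite (translation_invariant_bd z (@transfer_homotopy_translate n.+1)) dz !raddf0 addr0.
rewrite of_barK linearZ /= => ->.
by rewrite scalerBr -linearZ_LR /= -scaler_nat scalerA mulVf // scale1r.
Qed.

End Transfer.

(** [rho x] is the first entry of a fixed list lying in the right coset of [x], so it depends on the
    coset only; [f x] is read off from [x * (rho x)^-1]. *)
Lemma finite_index_transversal (H K : groupType) (al : {multiplicative H -> K})
    (A : groupClosed K) :
  injective al -> (forall x, reflect (exists h, al h = x) (x \in A)) -> finite_index A ->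
  exists (f : K -> H) (R : seq K), [/\ forall h x, f (al h * x) = h * f x,
    forall x, (al (f x))^-1 * x \in R, forall r, r \in R -> f r = 1, uniq R & (0 < size R)%N].
Proof.
(* Inverting representatives of left cosets gives representatives of right cosets. *)
move=> al_inj imP [R0 R0P]; pose s := [seq r^-1 | r <- R0].
pose in_coset x g := x * g^-1 \in A.
have has_s x : has (in_coset x) s.
  have [r rR0 xA] := R0P x^-1; apply/hasP; exists r^-1; first exact: map_f.
  by rewrite /in_coset invgK -gpredV invgM.
pose rho x := nth 1 s (find (in_coset x) s).
have rho_s x : rho x \in s by rewrite mem_nth // -has_find.
have rhoA x : x * (rho x)^-1 \in A by exact: (nth_find 1 (has_s x)).
have rhoM a x : a \in A -> rho (a * x) = rho x.
  move=> aA; rewrite /rho; congr nth; apply: eq_find => g.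
  by rewrite /in_coset -mulgA gpredMl.
have rhoK x : rho (rho x) = rho x.
  rewrite -[RHS](rhoM (x * (rho x)^-1)^-1) ?gpredV //.
  by rewrite invgM invgK mulgVK.
have /choice[f fP] : forall x, exists h, al h = x * (rho x)^-1.
  by move=> ?; apply/imP.
have rhoE x : (al (f x))^-1 * x = rho x by rewrite fP invgM invgK mulgVK.
exists f, (undup (map rho s)); split=> [h x|x|r||].
- apply: al_inj; rewrite gmulfM !fP rhoM ?mulgA //.
  by apply/imP; exists h.
- by rewrite rhoE mem_undup -rhoK map_f.
- rewrite mem_undup => /mapP[g _ ->]; apply: al_inj.
  by rewrite fP rhoK mulgV gmorph1.
- exact: undup_uniq.
- have : rho (rho 1) \in undup (map rho s) by rewrite mem_undup map_f.
  by case: (undup _).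
Qed.

Lemma bar_map_comp (F G E : groupType) (a : {multiplicative F -> G})
    (b : {multiplicative G -> E}) (c : {multiplicative F -> E}) n (z : bar F n) :
  (forall x, b (a x) = c x) -> bar_map b (bar_map a z) = bar_map c z.
Proof.
move=> bac; rewrite -[LHS]/((@bar_map _ _ b n \o @bar_map _ _ a n) z).
apply: freeg_linear_ext => t; rewrite /= /bar_map !fgliftE.
congr (<< _ >>)%R; apply: eq_from_tnth => i; rewrite !tnth_map; exact: bac.
Qed.

(** * Cycles on finitely generated subgroups and surjectivity on homology *)

Section SubgroupBar.
Variables (E : groupType) (K : groupClosed E).

(** Entries outside [K] are sent to 1, so this is only a linear retraction: it pulls back chains
    supported in [K] and shows that the inclusion is injective on chains. *)
Definition bar_restrict n : bar E n -> bar (subgroup K) n :=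
  fglift (fun t : n.-tuple E => << [tuple of map (insubd (1%g : subgroup K)) t] >>%R).
HB.instance Definition _ n := GRing.Linear.copy (@bar_restrict n) (fglift _).

Lemma bar_restrictK n (c : bar (subgroup K) n) :
  bar_restrict (bar_map (sgval_morph K) c) = c.
Proof.
rewrite -[LHS]/((@bar_restrict n \o @bar_map _ _ (sgval_morph K) n) c) -[RHS]/(idfun c).
apply: freeg_linear_ext => t; rewrite /= /bar_restrict /bar_map !fgliftE.
congr (<< _ >>)%R; apply: eq_from_tnth => i; rewrite !tnth_map; exact: valKd.
Qed.

Lemma bar_map_restrict n (z : bar E n) :
  {in dom z, forall t, {in tval t, forall x, x \in K}} ->
  bar_map (sgval_morph K) (bar_restrict z) = z.
Proof.
move=> zK; rewrite -{2}(freeg_sumE z) -{1}(freeg_sumE z) !raddf_sum.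
rewrite big_seq [RHS]big_seq; apply: eq_bigr => t tz /=.
rewrite freegUZ !linearZ /= /bar_restrict /bar_map !fgliftE; congr (_ *: << _ >>)%R.
apply: eq_from_tnth => i; rewrite !tnth_map; apply: insubdK.
by apply: (zK t tz); rewrite mem_tnth.
Qed.

End SubgroupBar.

Section Image.
Variables (F E : groupType) (phi : {multiplicative F -> E}).

Let P x := exists h, phi h = x.
Let P1 : P 1. Proof. by exists 1; rewrite gmorph1. Qed.
Let PM x y : P x -> P y -> P (x * y).
Proof. by move=> [h <-] [k <-]; exists (h * k); rewrite gmulfM. Qed.
Let PV x : P x -> P x^-1. Proof. by move=> [h <-]; exists h^-1; rewrite gmorphV. Qed.

Definition image_closed : groupClosed E := subgroup_of P1 PM PV.

Lemma image_closedP x : reflect (exists h, phi h = x) (x \in image_closed).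
Proof. exact: subgroup_ofP. Qed.

End Image.

Lemma homology_surj (F E : groupType) (phi : {multiplicative F -> E}) n :
  (forall z : barcycle E n, exists (w : barcycle F n) v,
     bar_d v = (val z - bar_map phi (val w))%R) ->
  forall y : homology E n, exists x, homology_map phi x = y.
Proof.
move=> surj; elim/quotW=> z; have [w [v dv]] := surj z.
exists (homology_class w); rewrite homology_mapE; apply/quotm_eqP/asboolP.
by exists (- v)%R; rewrite raddfN /= dv opprB.

Qed.

Theorem root_dense_homology (F E : groupType) (phi : {multiplicative F -> E}) n :
  injective phi -> nilpotentg E -> (forall x, root_in (image_closed phi) x) ->
  forall y : homology E n, exists x, homology_map phi x = y.
Proof.
move=> phi_inj nilE rootE; apply: homology_surj; case: n => [|n] [z zc] /=.
  pose r : {linear bar E 0 -> bar F 0} := fglift (fun=> << [tuple] >>%R).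
  have rc : r z \in @bar_cycle F 0 by [].
  exists (BarCycle rc), 0%R; rewrite raddf0 /=; apply/esym/eqP.
  rewrite subr_eq0; apply/eqP.
  pose g : {linear bar E 0 -> bar E 0} := @bar_map _ _ phi 0 \o r.
  rewrite -[RHS]/(g z); apply: (freeg_linear_ext (f := idfun)) => t.
  rewrite /= fgliftE /bar_map fgliftE.
  by congr (<< _ >>)%R; apply: eq_from_tnth => -[].
(* [K] is generated by the finitely many group elements that occur in [z]. *)
pose S := flatten [seq tval t | t <- dom z]; pose K := gen [in S].
have zK : {in dom z, forall t, {in tval t, forall x, x \in K}}.
  move=> t tz x xt; apply: mem_gen; suff: x \in S by [].
  by apply/flatten_mapP; exists t.
pose z' := bar_restrict K z.
have z'E : bar_map (sgval_morph K) z' = z by exact: bar_map_restrict.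
have dz' : bar_d z' = 0%R.
  by rewrite -[LHS](bar_restrictK (K := K)) -bar_map_d z'E (eqP zc) raddf0.
pose A := preim_closed (sgval_morph K) (image_closed phi).
have finA : finite_index A by apply: gen_finite_index.
have AP x : reflect (exists h, sgval_morph A h = x) (x \in A).
  apply: (iffP idP) => [xA|[h <-]]; last exact: valP.
  by exists (Subgroup xA).
have [f [R [f1 f2 f3 f4 f5]]] := finite_index_transversal (@sgval_morph_inj _ A) AP finA.
have [w dw [v dv]] := transfer_surjective f1 f2 f3 f4 dz' f5.
(* The transferred cycle lives on [A], whose elements lie in the image of [phi]; injectivity of
   [phi] makes the choice of preimages a homomorphism. *)
have /choice[io ioP] : forall h : subgroup A, exists g, phi g = val (val h).
  by move=> h; apply/image_closedP; have := valP h; rewrite mem_preim.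
have ioM : {morph io : x y / x * y}.
  by move=> x y; apply: phi_inj; rewrite gmulfM !ioP !valM.
have wc : bar_map (mulmorph ioM) w \in @bar_cycle F n.+1.
  by rewrite unfold_in /= bar_map_d dw raddf0.
exists (BarCycle wc), (bar_map (sgval_morph K) v).
rewrite bar_map_d dv raddfB /= z'E; congr (_ - _)%R.
rewrite (bar_map_comp (c := phi \o mulmorph ioM)) => [|x]; last by rewrite /= ioP.
by rewrite (bar_map_comp (c := phi \o mulmorph ioM)).
Qed.

(** * Malcev completions and the lower Q-central series *)

Lemma uniquely_divisibleP (G : groupType) :
  uniquely_divisible G <-> forall n, (0 < n)%N ->
    injective (fun x : G => x ^+ n) /\ forall x : G, exists y, y ^+ n = x.
Proof.
split=> [divG n /divG[g gK Kg]|divG n /divG[inj /choice[g gE]]].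
  by split=> [|x]; [exact: can_inj gK | exists (g x)].
by exists g => // x; apply: inj; rewrite gE.
Qed.

(** The root closure of the image is again a uniquely divisible nilpotent group,
    so the universal property retracts the Malcev completion onto it. *)
Lemma malcev_root_dense (N L : groupType) (r : {multiplicative N -> L}) x :
  is_malcev r -> root_in (image_closed r) x.
Proof.
move=> [_ nilL divL univ]; pose D := root_closure (image_closed r) nilL.
have rD y : r y \in D.
  by apply/root_closureP; exists 1%N => //; apply/image_closedP; exists y.
pose f y := Subgroup (rD y).
have fM : {morph f : y z / y * z} by move=> y z; apply: val_inj; rewrite valM /= gmulfM.
have divD : uniquely_divisible (subgroup D).
  apply/uniquely_divisibleP => n n_gt0; have /uniquely_divisibleP/(_ n n_gt0)[inj surj] := divL.
  split=> [y z yz|y].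
    apply: (@sgval_morph_inj _ D); apply: inj; rewrite -!gmorphX; congr (sgval_morph D _).
    exact: yz.
  have [z zy] := surj (val y); have zD : z \in D.
    have /root_closureP[m m_gt0 ymr] := valP y; apply/root_closureP.
    by exists (n * m)%N; rewrite ?muln_gt0 ?n_gt0 // expgnA zy.
  by exists (Subgroup zD); apply: val_inj; rewrite -zy -[LHS]/(sgval_morph D _) gmorphX.
have [g [gr _]] := univ _ (mulmorph fM) (nilpotent_subgroup D nilL) divD.
(* The identity of [L] and the retraction through [D] both extend [r], so uniqueness identifies
   them. *)
have [i [_ iuniq]] := univ _ r nilL divL.
have id_i : idfun =1 i by apply: (iuniq idfun).
have -> : x = val (g x).
  rewrite -[LHS]/(idfun x) id_i; apply/esym.
  by apply: (iuniq (sgval_morph D \o g)) => y; rewrite /= gr.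
exact/root_closureP/valP.
Qed.

Lemma intfreeg_ext (A : choiceType) (V : zmodType) (f g : {additive {freeg A / int} -> V}) :
  (forall x, f << x >>%R = g << x >>%R) -> f =1 g.
Proof.
move=> fg z; rewrite -(freeg_sumE z) !raddf_sum; apply: eq_bigr => x _ /=.
by rewrite -[coeff x z]intz -freegU_mulz !raddfMz fg.
Qed.

Lemma scale_denq (V : lmodType rat) (u : V) (a : rat) (q : nat) :
  denq a = q -> ((a *: u) *+ q = u *~ numq a)%R.
Proof.
by move=> aE; rewrite -scaler_nat -scaler_int scalerA numqE aE mulrC -pmulrn.
Qed.

Lemma spanm_ind (R : pzRingType) (V : lmodType R) (S : V -> Prop) (W : V -> Prop) :
  W 0%R -> (forall a u v, W u -> W v -> W (a *: u + v)%R) -> (forall v, S v -> W v) ->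
  forall v, v \in spanm S -> W v.
Proof.
move=> W0 WD WS v; pose p : {pred V} := fun v => `[< W v >].
have pP : submod_closed p.
  split=> [|a x y /asboolP xW /asboolP yW]; apply/asboolP => //; exact: WD.
pose P : submodClosed V := HB.pack_for (submodClosed V) p
  (GRing.isSubmodClosed.Build R V p pP).
by move/asboolP/(_ P) => vP; apply/asboolP/vP => w Sw; apply/asboolP/WS.
Qed.

(** An additive copy of a commutative group, so that [fglift] applies to it. *)
Definition additive_copy (A : groupType) of (forall x y : A, x * y = y * x) : Type := A.

Section AdditiveCopy.
Variables (A : groupType) (cA : forall x y : A, x * y = y * x).

HB.instance Definition _ := Choice.copy (additive_copy cA) A.

Lemma additive_copy_mulV : left_inverse 1 (@monoid.inv A) (@monoid.mul A). Proof. exact: mulVg. Qed.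

HB.instance Definition _ := GRing.isZmodule.Build (additive_copy cA)
  (@mulgA A) cA (@mul1g A) additive_copy_mulV.

End AdditiveCopy.

Section TensQTorsion.
Variables (A : groupType) (cA : forall x y : A, x * y = y * x).

Local Notation addA := (additive_copy cA).
Let ZA := {freeg A / int}.
Let ev : {additive ZA -> zmodule addA} := fglift (fun x : A => x : zmodule addA).
Let rat_of : {additive ZA -> zmodule {freeg A / rat}} :=
  fglift (fun x : A => << x >>%R : zmodule {freeg A / rat}).

Let evE x : ev << x >>%R = x. Proof. by rewrite /= liftU scale1r. Qed.
Let rat_ofE x : rat_of << x >>%R = << x >>%R. Proof. by rewrite /= liftU scale1r. Qed.

Let coeff_rat_of x w : coeff x (rat_of w : {freeg A / rat}) = ((coeff x w)%:~R)%R.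
Proof.
rewrite -[LHS]/((coeff x \o rat_of) w) -[RHS]/((intr \o coeff x) w).
by apply: intfreeg_ext => y; rewrite /= rat_ofE !coeffU !mul1r rmorph_nat.
Qed.

Let rat_of_inj : injective rat_of.
Proof.
move=> w w' ww'; apply/eqP/freeg_eqP => x; apply: (@intr_inj rat).
by rewrite -!coeff_rat_of ww'.
Qed.

(** Clearing denominators: an integral combination of symbols that dies in the
    tensor product has torsion value in [A]. *)
Let W (v : {freeg A / rat}) := exists2 N, (0 < N)%N & exists2 w : ZA,
  (v *+ N = rat_of w)%R & exists2 k, (0 < k)%N & (ev w *+ k = 0)%R.

Lemma spanm_tensQ_rel v : v \in spanm (@tensQ_rel A) -> W v.
Proof.
have W0 : W 0%R.
  exists 1%N => //; exists 0%R; first by rewrite raddf0.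
  by exists 1%N; rewrite ?raddf0.
have WD a u u' : W u -> W u' -> W (a *: u + u')%R.
  move=> [N N0 [w uw [k k0 wk]]] [N' N'0 [w' uw' [k' k'0 wk']]].
  have := denq_gt0 a; case aE : (denq a) => [q|//]; rewrite ltz_nat => q0.
  exists (q * (N * N'))%N; first by rewrite !muln_gt0 q0 N0.
  exists (w *~ numq a *+ N' + w' *+ (q * N))%R.
    have au := scale_denq u aE.
    rewrite raddfD !raddfMn raddfMz /= -uw -uw' mulrnDl; congr (_ + _)%R.
      by rewrite mulrnA au mulrnA; congr (_ *+ _)%R; rewrite !pmulrn mulrzAC.
    by rewrite -mulrnA mulnA mulnC.
  exists (k * k')%N; first by rewrite muln_gt0 k0.
  rewrite raddfD !raddfMn raddfMz /= mulrnDl.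
  have -> : ((ev w *~ numq a *+ N') *+ (k * k') = (ev w *+ k) *~ numq a *+ (N' * k'))%R.
    by rewrite -mulrnA mulnCA mulrnA; congr (_ *+ _)%R; rewrite !pmulrn mulrzAC.
  have -> : ((ev w' *+ (q * N)) *+ (k * k') = (ev w' *+ k') *+ (q * N * k))%R.
    by rewrite -!mulrnA; congr (_ *+ _)%R; rewrite mulnA mulnC.
  by rewrite wk wk' mul0rz !mul0rn addr0.
apply: spanm_ind W0 WD _ v => _ [x [y ->]].
exists 1%N => //; exists (<< (x * y)%g >> - << x >> - << y >>)%R.
  by rewrite !raddfB /= !rat_ofE.
exists 1%N => //; rewrite mulr1n !raddfB /= !evE; apply/eqP.
by rewrite -addrA -opprD subr_eq0; apply/eqP.
Qed.

(** Clearing denominators for [<< x >>] forces [w] to be [N] times [<< x >>], since [rat_of] is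
    injective; hence [x ^+ N] is torsion. *)
Lemma tensQ_in_eq0 (x : A) : tensQ_in x = 0%R -> exists2 k, (0 < k)%N & x ^+ k = 1.
Proof.
move/quotm_eqP; rewrite subr0 => /spanm_tensQ_rel[N N0 [w xw [k k0 wk]]].
exists (N * k)%N; first by rewrite muln_gt0 N0.
have wE : w = (<< x >> *+ N)%R by apply: rat_of_inj; rewrite -xw raddfMn /= rat_ofE.
have mulXE (y : A) n : ((y : zmodule addA) *+ n)%R = y ^+ n.
  by elim: n => // n IHn; rewrite mulrS expgS IHn.
by move: wk; rewrite wE raddfMn /= evE !mulXE expgnA.
Qed.

End TensQTorsion.

(** The quotient by the commutator subgroup is abelian, so the kernel of its map to the rational
    tensor product is torsion. *)
Lemma gammaQ_root (G : groupType) i x : x \in gammaQ G i.+1 ->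
  x \in gammaQ G i /\ root_in (commG (gammaQ G i)) x.
Proof.
move=> /asboolP[u [<- u0]]; split; first exact: valP.
pose piH := quotg_pi (@commGin G (gammaQ G i)).
have comm_quot : forall a b : quotg (@commGin G (gammaQ G i)), a * b = b * a.
  elim/quotW=> a; elim/quotW=> b.
  have piM c d : piH (c * d) = piH c * piH d by exact: gmulfM.
  rewrite -[LHS](piM a b) -[RHS](piM b a); apply/quotg_eqP; rewrite unfold_in /commGin.
  have -> : (a * b)^-1 * (b * a) = [~ b, a] by rewrite /commg /conjg invgM !mulgA.
  by rewrite -[val _]/(sgval_morph _ _) gmorphR mem_commG //; exact: valP.
have [k k_gt0] := tensQ_in_eq0 comm_quot u0.
rewrite -[quotg_pi _ u]/(piH u) -gmorphX -(gmorph1 piH) => /quotg_eqP.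
rewrite mulg1 gpredV unfold_in /commGin -[val _]/(sgval_morph _ _) gmorphX => ukH.
by exists k.
Qed.

(** Each term of the series consists of roots of products of commutators from the previous term, so
    a central filtration with torsion-free factors contains its image. *)
Lemma gammaQ_filtration (G E : groupType) (psi : {multiplicative G -> E})
    (N : nat -> groupClosed E) :
  (forall x, x \in N 0%N) ->
  (forall i x y, x \in N i -> [~ x, y] \in N i.+1) ->
  (forall i x n, (0 < n)%N -> x \in N i -> x ^+ n \in N i.+1 -> x \in N i.+1) ->
  forall i x, x \in gammaQ G i -> psi x \in N i.
Proof.
move=> N0 NR Nroot; elim=> [|i IHi] x; first by rewrite N0.
move=> /gammaQ_root[/IHi xi [n n_gt0 xn]]; apply: (Nroot _ _ n) => //.
rewrite -gmorphX; move: {xi n_gt0} (x ^+ n) xn.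
apply: (commG_ind (P := fun z => psi z \in N i.+1)) => [|y z yN zN|y yN|y z /IHi yi].
- by rewrite gmorph1 gpred1.
- by rewrite gmulfM gpredM.
- by rewrite gmorphV gpredV.
- by rewrite gmorphR NR.
Qed.

Lemma filtration_nilpotent (E : groupType) (N : nat -> groupClosed E) c :
  (forall x, x \in N 0%N) ->
  (forall i x y, x \in N i -> [~ x, y] \in N i.+1) ->
  (forall x, x \in N c -> x = 1) -> nilpotentg E.
Proof.
move=> N0 NR Nc; exists c => x xc; apply: Nc; move: xc.
elim: c x => [|i IHi] x; first by rewrite N0.
apply: (commG_ind (P := fun z => z \in N i.+1)) => [|y z yN zN|y yN|y z /IHi yi].
- exact: gpred1.
- exact: gpredM.
- by rewrite gpredV.
- exact: NR.
Qed.

(** * Rational powers of a unipotent operator *)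

Section PolyAction.
Variables (V : lmodType rat) (S : {linear V -> V}).
Implicit Types (p q : {poly rat}) (v : V).

Lemma iter_is_linear n : linear (iter n S).
Proof. by elim: n => [//|n IHn] a u v; rewrite /= IHn linearP. Qed.
HB.instance Definition _ n := GRing.isLinear.Build rat V V _ (iter n S) (iter_is_linear n).

(** This is [p(S) v]: [V] as a module over the rational polynomials. *)
Definition pact p v : V := (\sum_(i < size p) p`_i *: iter i S v)%R.

Lemma pactE n p v : (size p <= n)%N -> pact p v = (\sum_(i < n) p`_i *: iter i S v)%R.
Proof.
move=> pn; rewrite /pact (big_ord_widen _ (fun i => p`_i *: iter i S v)%R pn) big_mkcond.
by apply: eq_bigr => i _; case: ltnP => // /leq_sizeP/(_ i (leqnn _))->; rewrite scale0r.
Qed.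

Lemma pact_is_linear p : linear (pact p).
Proof.
move=> a u v; rewrite /pact scaler_sumr -big_split; apply: eq_bigr => i _.
by rewrite linearP /= scalerDr !scalerA mulrC.
Qed.
HB.instance Definition _ p := GRing.isLinear.Build rat V V _ (pact p) (pact_is_linear p).

Lemma pactD p q v : pact (p + q)%R v = (pact p v + pact q v)%R.
Proof.
rewrite !(@pactE (maxn (size p) (size q))) ?leq_maxl ?leq_maxr ?size_polyD //.
by rewrite -big_split; apply: eq_bigr => i _; rewrite coefD scalerDl.
Qed.

Lemma pactZ a p v : pact (a *: p)%R v = (a *: pact p v)%R.
Proof.
rewrite !(@pactE (size p)) ?size_scale_leq // scaler_sumr.
by apply: eq_bigr => i _; rewrite coefZ scalerA.
Qed.

Lemma pact0 v : pact 0%R v = 0%R. Proof. by rewrite /pact size_poly0 big_ord0. Qed.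

Lemma pactN p v : pact (- p)%R v = (- pact p v)%R.
Proof. by have := pactZ (-1) p v; rewrite !scaleN1r. Qed.

Lemma pactB p q v : pact (p - q)%R v = (pact p v - pact q v)%R.
Proof. by rewrite pactD pactN. Qed.

Lemma pactC c v : pact c%:P%R v = (c *: v)%R.
Proof. by rewrite (@pactE 1) ?size_polyC ?leq_b1 // big_ord1 coefC. Qed.

Lemma pact1 v : pact 1%R v = v. Proof. by rewrite pactC scale1r. Qed.

Lemma pactXn n v : pact 'X^n%R v = iter n S v.
Proof.
rewrite (@pactE n.+1) ?size_polyXn // big_ord_recr /= coefXn eqxx scale1r big1 ?add0r // => i _.
by rewrite coefXn ltn_eqF // scale0r.
Qed.

Lemma pactMX p v : pact (p * 'X)%R v = S (pact p v).
Proof.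
have sz : (size (p * 'X)%R <= (size p).+1)%N.
  by rewrite (leq_trans (size_polyMleq _ _)) // size_polyX addn2.
rewrite (pactE _ sz) big_ord_recl coefMX /= scale0r add0r raddf_sum.
by apply: eq_bigr => i _; rewrite coefMX /= linearZ.
Qed.

Lemma pactM p q v : pact (p * q)%R v = pact p (pact q v).
Proof.
elim/poly_ind: p => [|p c IHp]; first by rewrite mul0r !pact0.
rewrite mulrDl !pactD mul_polyC pactZ pactC mulrAC !pactMX.
by rewrite IHp.
Qed.

Lemma pactX v : pact 'X%R v = S v. Proof. by rewrite -(expr1 'X%R) pactXn. Qed.

Lemma pact_comm p q v : pact p (pact q v) = pact q (pact p v).
Proof. by rewrite -!pactM mulrC. Qed.

End PolyAction.

(** Generalized binomial coefficients: a unipotent [t = 1 + S] has rational powers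
    [t^s = sum_k gbin s k * S^k]. *)
Fixpoint gbin (s : rat) (k : nat) : rat :=
  if k is j.+1 then (gbin s j * (s - j%:R) / j.+1%:R)%R else 1%R.

Lemma gbinS s k : (k.+1%:R * gbin s k.+1 = gbin s k * (s - k%:R))%R.
Proof. by rewrite /= mulrC divfK // pnatr_eq0. Qed.

(** Vandermonde's convolution: after multiplication by [k.+1], this factor splits as
    [i + (k.+1 - i)] and [gbinS] absorbs each part. *)
Lemma gbin_add (s t : rat) k :
  (gbin (s + t) k = \sum_(i < k.+1) gbin s i * gbin t (k - i))%R.
Proof.
elim: k => [|k IHk]; first by rewrite big_ord1 /= mulr1.
have k0 : (k.+1%:R != 0 :> rat)%R by rewrite pnatr_eq0.
apply: (mulfI k0); rewrite gbinS IHk mulr_suml mulr_sumr.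
have -> : (\sum_(i < k.+2) k.+1%:R * (gbin s i * gbin t (k.+1 - i)) =
  \sum_(i < k.+2) i%:R * gbin s i * gbin t (k.+1 - i)%N +
  \sum_(i < k.+2) gbin s i * ((k.+1 - i)%N%:R * gbin t (k.+1 - i)))%R.
  rewrite -big_split; apply: eq_bigr => i _ /=.
  rewrite mulrA [(gbin s i * _)%R]mulrCA mulrA -mulrDl -mulrDl.
  by rewrite -natrD subnKC // -ltnS.
rewrite [X in _ = (X + _)%R]big_ord_recl !mul0r add0r.
rewrite [X in _ = (_ + X)%R]big_ord_recr /= subnn mul0r mulr0 addr0 -big_split.
apply: eq_bigr => i _ /=.
rewrite /bump leq0n add1n subSS subSn ?leq_ord // !gbinS natrB ?leq_ord //.
rewrite -[RHS]/(_ + _)%R [(gbin s i * (s - _) * _)%R]mulrAC.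
rewrite [(gbin s i * (gbin t _ * _))%R]mulrA -mulrDr; congr (_ * _)%R.
by rewrite addrACA opprB addKr.
Qed.

Lemma gbin0S k : gbin 0 k.+1 = 0%R.
Proof.
elim: k => [|k IHk]; first by rewrite /= subrr mulr0 mul0r.
by rewrite -[LHS]/(gbin 0 k.+1 * _ / _)%R IHk !mul0r.
Qed.

Lemma gbin1S k : gbin 1 k.+2 = 0%R.
Proof.
elim: k => [|k IHk]; first by rewrite /= subrr mulr0 mul0r.
by rewrite -[LHS]/(gbin 1 k.+2 * _ / _)%R IHk !mul0r.
Qed.

Lemma bezout_poly (p q : {poly rat}) : coprimep p q -> exists u, (u.1 * p + u.2 * q = 1)%R.
Proof.
move/Bezout_coprimepP => [u]; rewrite -size_poly_eq1 => /size_poly1P[c c0 uE].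
exists (c^-1 *: u.1, c^-1 *: u.2)%R; rewrite -!scalerAl -scalerDr uE.
by rewrite -mul_polyC -polyCM mulVf.
Qed.

Section UnipotentAction.
Variables (V : lmodType rat) (S : {linear V -> V}) (d : nat).
Hypothesis S_nil : forall v, iter d.+2 S v = 0%R.

(** The binomial series of [(1 + X)^s] modulo ['X^(d.+2)]. At least two coefficients survive, so
    [B 1] is exactly [1 + 'X]. *)
Local Notation B := (fun s : rat => \poly_(j < d.+2) gbin s j)%R.

Let pactB_add s t v : pact S (B (s + t)%R) v = pact S (B s) (pact S (B t) v).
Proof.
rewrite -pactM -[in RHS](poly_take_drop d.+2 (B s * B t)%R) pactD pactM pactXn S_nil raddf0 addr0.
congr pact; apply/polyP => k; rewrite coef_poly coef_take_poly; case: ltnP => // k_lt.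
rewrite gbin_add coefM; apply: eq_bigr => i _; rewrite !coef_poly.
by rewrite (leq_ltn_trans (leq_ord i)) // (leq_ltn_trans (leq_subr _ _)).
Qed.

Let pactB0 v : pact S (B 0%R) v = v.
Proof.
have -> : B 0%R = 1%R; last exact: pact1.
apply/polyP => -[|k]; rewrite coef_poly coef1 //.
by rewrite gbin0S if_same.
Qed.

Definition unip : gmodule (Algebra.to_multiplicative rat) V :=
  @GModule (Algebra.to_multiplicative rat) V (fun s v => pact S (B s) v)
    (fun s x y => raddfD (pact S (B s)) x y) pactB0 (fun s t => pactB_add s t).

Lemma unipE s v : unip s v = pact S (B s) v. Proof. by []. Qed.

Lemma unip1 v : unip (1%R : rat) v = (v + S v)%R.
Proof.
rewrite unipE; have -> : B 1%R = (1 + 'X)%R; last by rewrite pactD pact1 pactX.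
by apply/polyP => -[|[|k]]; rewrite coef_poly coefD coef1 coefX // gbin1S if_same.
Qed.

Local Notation E := (semidirect unip).

(** [p] is the sum of the powers of [B x.2] with exponent below [n]; for positive [n] its nonzero
    constant term makes [p(S)] invertible. *)
Lemma unip_expg (x : E) n :
  exists2 p : {poly rat}, p.[0]%R = n%:R%R &
    forall v, ((v, x.2) : E) ^+ n = (pact S p v, x.2 *+ n)%R.
Proof.
elim: n => [|n [p p0 IHp]].
  by exists 0%R => [|v]; rewrite ?horner0 // pact0.
exists (1 + B x.2 * p)%R => [|v].
  rewrite hornerD hornerM hornerC p0 horner_coef0 coef_poly /= mul1r.
  by rewrite mulrS.
by rewrite expgS IHp pactD pact1 pactM mulrS.
Qed.

Lemma pact_bij p : (p.[0] != 0)%R -> bijective (pact S p).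
Proof.
move=> p0; have : coprimep p ('X^(d.+2))%R by rewrite coprimep_expr // coprimepX.
move/bezout_poly => [u uE].
have uK v : pact S u.1 (pact S p v) = v.
  by rewrite -[RHS](pact1 S) -uE pactD (pactM S u.1) (pactM S u.2) pactXn S_nil raddf0 addr0.
by exists (pact S u.1) => // v; rewrite pact_comm.
Qed.

Lemma unip_uniquely_divisible : uniquely_divisible E.
Proof.
apply/uniquely_divisibleP => n n_gt0.
have n0 : (n%:R != 0 :> rat)%R by rewrite pnatr_eq0 -lt0n.
split=> [[v s] [w t] /= | [w t]].
  have [p p0 pP] := unip_expg (v, s) n; have [q q0 qP] := unip_expg (w, t) n.
  move=> E1; have := E1; rewrite pP qP /= => -[_ st'].
  have {st'} st : s = t by apply: (mulIf n0); rewrite !mulr_natr.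
  move: E1; rewrite -st !pP => -[pvw]; congr (_, _).
  have [g pK _] : bijective (pact S p) by apply: pact_bij; rewrite p0.
  by rewrite -[v]pK pvw pK.
have [p p0 pP] := unip_expg (0%R, (t / n%:R)%R) n.
have [g _ pK] : bijective (pact S p) by apply: pact_bij; rewrite p0.
exists (g w, (t / n%:R)%R); rewrite pP pK /=; congr (_, _).
by rewrite -[LHS]mulr_natr divfK.
Qed.

(** The whole group, then inside [V] the kernels of [S^(d+2)], [S^(d+1)], and so on; term [d.+3] is
    trivial. *)
Let NP i (x : E) := if i is j.+1 then x.2 = 0%R /\ iter (d.+2 - j) S x.1 = 0%R else True.

Let N1 i : NP i 1. Proof. by case: i => //= i; rewrite raddf0. Qed.
Let NM i x y : NP i x -> NP i y -> NP i (x * y).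
Proof.
case: i => //= i [x2 x1] [y2 y1]; rewrite x2 y2; split; first exact: (addr0 (0%R : rat)).
by rewrite raddfD /= x1 pactB0 y1 addr0.
Qed.
Let NV i x : NP i x -> NP i x^-1.
Proof.
case: i => //= i [x2 x1]; rewrite x2; split; first exact: (@oppr0 rat).
by rewrite raddfN /= -pactXn pact_comm pactXn x1 raddf0 oppr0.
Qed.

Definition unip_filtration i : groupClosed E := subgroup_of (@N1 i) (@NM i) (@NV i).

Let NPP i x : reflect (NP i x) (x \in unip_filtration i). Proof. exact: subgroup_ofP. Qed.

Lemma unip_filtration0 x : x \in unip_filtration 0. Proof. exact/NPP. Qed.

Lemma unip_filtration_top i x : (d.+3 <= i)%N -> x \in unip_filtration i -> x = 1.
Proof.
case: i => // i di; case: x => v s /NPP /= [->].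
by rewrite (eqP (di : (d.+2 - i == 0)%N)) /= => ->.
Qed.

Lemma unip_filtration_commg i x y : x \in unip_filtration i -> [~ x, y] \in unip_filtration i.+1.
Proof.
move=> /NPP xN; apply/NPP; case: i xN => [_|i [x2 x1]].
  split; last by rewrite S_nil.
  have abE (a b : rat) : (- a + (- b + (a + b)) = 0)%R by rewrite addrA -opprD addNr.
  exact: (abE x.2 y.2).
(* For [x] in [V] the commutator depends on [y] only through its rational part. *)
pose c := (unip (- y.2 : rat) x.1 - x.1)%R.
have -> : [~ x, y] = (c, 0%R).
  apply: (mulgI (y * x)); rewrite -commgC; case: x x2 @c {x1} => v s /= ->.
  case: y => w t; congr (_, _); last first.
    by have stE (s' t' : rat) : (0 + s' = s' + 0 + 0)%R; [rewrite addr0 addrC|exact: stE].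
  rewrite /= pactB0; have -> : pact S (B (t * 0)) = unip t by rewrite -[(t * 0)]/(t + 0)%R addr0.
  rewrite unipE raddfB /= -pactB_add subrr pactB0 addrC -addrA; congr (_ + _)%R.
  by rewrite addrC subrK.
split=> //=; rewrite /c unipE; move: x.1 x1 (- y.2 : rat)%R => v v0 s.
(* [B s] has constant term 1, so [B s - 1] has a factor ['X], which gives one more application of
   [S]. *)
have [r rE] : exists r, (B s - 1 = r * 'X)%R.
  suff /factor_theorem[r rE] : root (B s - 1)%R 0%R by exists r; rewrite rE subr0.
  by rewrite rootE hornerD hornerN hornerC horner_coef0 coef_poly /= subrr.
rewrite -[X in (_ - X)%R](pact1 S) -pactB rE pactMX -iterSr -pactXn pact_comm pactXn.
(* Truncated subtraction: for [i] at least [d.+2] the hypothesis already says that [v] is zero. *)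
have [id2|di] := ltnP i d.+2; first by rewrite subnSK // v0 raddf0.
by move: v0; rewrite (eqP di) /= => ->; rewrite !raddf0.
Qed.

Lemma unip_filtration_root i x n : (0 < n)%N ->
  x ^+ n \in unip_filtration i.+1 -> x \in unip_filtration i.+1.
Proof.
case: x => v s n_gt0 /NPP; have n0 : (n%:R != 0 :> rat)%R by rewrite pnatr_eq0 -lt0n.
have [p p0 pP] := unip_expg (v, s) n; rewrite pP => -[/= x2 x1].
apply: (introT (NPP i.+1 (v, s))); split=> /=.
  by apply/eqP; move/eqP: x2; rewrite mulrn_eq0 eqn0Ngt n_gt0.
have [g pK _] : bijective (pact S p) by apply: pact_bij; rewrite p0.
by apply: (can_inj pK); rewrite raddf0 -pactXn pact_comm pactXn.
Qed.

Lemma unip_nilpotent : nilpotentg E.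
Proof.
apply: (@filtration_nilpotent E unip_filtration d.+3).
- exact: unip_filtration0.
- exact: unip_filtration_commg.
- by move=> x; exact: unip_filtration_top.
Qed.

End UnipotentAction.

(** * The module [M] and its rationalization *)

(** Every element is [t ^+ a * t ^- b], and injectivity of the powers of [t] makes [a - b]
    independent of the choice. *)
Lemma infinite_cyclic_exponent (C : groupType) : infinite_cyclic C ->
  exists (t : C) (ex : C -> rat), [/\ forall c c', ex (c * c')%g = (ex c + ex c')%R,
    ex t = 1%R, forall c, ex c = 0%R -> c = 1
    & forall x : C, exists n, x = t ^+ n \/ x = t ^- n].
Proof.
move=> [t [t_inj tP]]; exists t.
have tab (x : C) : exists ab : nat * nat, x = t ^+ ab.1 * t ^- ab.2.
  by have [n [->|->]] := tP x; [exists (n, 0%N) | exists (0%N, n)];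
    rewrite /= ?expg0 ?mul1g ?invg1 ?mulg1.
have /choice[ab abE] := tab.
have tE a b b' : t ^+ a * t ^- b * t ^+ (b + b') = t ^+ (a + b').
  by rewrite !expgnDr mulgA mulgVK.
pose ex a b : rat := (a%:R - b%:R)%R.
have exP c a b : c = t ^+ a * t ^- b -> ex (ab c).1 (ab c).2 = ex a b.
  rewrite {1}(abE c); case: (ab c) => a' b' /= E.
  have /(congr1 (fun n => n%:R : rat)%R) : (a' + b = a + b')%N.
    by apply: t_inj; rewrite /= -(tE a' b') E addnC tE.
  by rewrite !natrD /ex => E1; apply/eqP; rewrite subr_eq addrAC -E1 addrK.
exists (fun c => ex (ab c).1 (ab c).2); split=> [c c'||c|//].
- rewrite (exP (c * c') ((ab c).1 + (ab c').1)%N ((ab c).2 + (ab c').2)%N).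
    by rewrite /ex !natrD opprD addrACA.
  rewrite {1}(abE c) {1}(abE c'); move: (ab c) (ab c') => [a b] [a' b'] /=.
  have tb : commute (t ^+ a') (t ^- b) by exact/commuteV/commuteX2.
  by rewrite [(b + b')%N]addnC !expgnDr invgM !mulgA; congr (_ * _); rewrite -!mulgA tb.
- by rewrite (exP t 1%N 0%N) /ex ?subr0 // invg1 mulg1.
move/eqP; rewrite subr_eq0 eqr_nat => /eqP E.
by rewrite (abE c) E mulgV.
Qed.

Lemma tensQ_lift (A : groupType) (W : lmodType rat) (f : A -> W) :
  (forall x y, f (x * y)%g = (f x + f y)%R) ->
  exists L : {linear tensQ A -> W}, forall x, L (tensQ_in x) = f x.
Proof.
move=> fM; pose g : {linear {freeg A / rat} -> W} := fglift f.
pose L (v : tensQ A) := g (repr v).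
have g0 w : w \in spanm (@tensQ_rel A) -> g w = 0%R.
  apply: (spanm_ind (W := fun w => g w = 0%R)) => [|a x y x0 y0|_ [x [y ->]]].
  - exact: raddf0.
  - by rewrite linearP x0 y0 scaler0 addr0.
  - by rewrite !raddfB /= !fgliftE fM addrAC addrK subrr.
have LE v : L (quotm_pi _ v) = g v.
  apply/esym/subr0_eq; rewrite /L -raddfB; apply: g0; exact: quotm_reprP.
have Llin : linear L.
  move=> a; elim/quotW=> u; elim/quotW=> v.
  by rewrite -!/(quotm_pi _ _) -linearP !LE linearP.
exists (HB.pack_for {linear tensQ A -> W} L (GRing.isLinear.Build rat _ W _ L Llin)).
by move=> x; rewrite /= LE /= fgliftE.
Qed.

Lemma tensQ_frac (A : groupType) (v : tensQ A) : (forall x y : A, x * y = y * x) ->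
  exists2 q, (0 < q)%N & exists x, (v *+ q)%R = tensQ_in x.
Proof.
move=> cA; pose P (v : tensQ A) := exists2 q, (0 < q)%N & exists x, (v *+ q)%R = tensQ_in x.
have tensQ_inX (x : A) n : tensQ_in (x ^+ n) = (tensQ_in x *+ n)%R.
  by elim: n => [|n IHn]; rewrite ?tensQ_in1 // expgS tensQ_inM IHn mulrS.
have PD u w : P u -> P w -> P (u + w)%R.
  move=> [q q0 [x ux]] [q' q'0 [y wy]]; exists (q * q')%N; first by rewrite muln_gt0 q0.
  exists (x ^+ q' * y ^+ q); rewrite tensQ_inM !tensQ_inX -ux -wy mulrnDl.
  by rewrite -!mulrnA [(q' * q)%N]mulnC.
have PZ a u : P u -> P (a *: u)%R.
  move=> [q q0 [x ux]].
  have := denq_gt0 a; case aE : (denq a) => [q'|//]; rewrite ltz_nat => q'0.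
  exists (q' * q)%N; first by rewrite muln_gt0 q'0.
  have -> : ((a *: u) *+ (q' * q) = (u *+ q) *~ numq a)%R.
    by rewrite mulrnA (scale_denq u aE) !pmulrn mulrzAC.
  rewrite ux; case: (numq a) => n; first by exists (x ^+ n); rewrite tensQ_inX.
  by exists (x ^- n.+1); rewrite tensQ_inV tensQ_inX NegzE mulrNz.
elim/quotW: v => v; rewrite -/(quotm_pi _ v) -(freeg_sumE v) raddf_sum.
apply: (big_ind P) => [||x _ /=]; last 1 first.
- by rewrite freegUZ linearZ; apply: PZ; exists 1%N => //; exists x.
- by exists 1%N => //; exists 1; rewrite tensQ_in1 mul0rn.
- exact: PD.
Qed.

(** If [p] annihilates [V] and [p = q * 'X^d] with [q] prime to ['X], a Bezout relation
    [u * q + h * 'X^d = 1] gives the projection [g = u * q] onto the kernel of a power of [T]. *)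
Lemma fitting_decomposition (V : lmodType rat) (T : {linear V -> V}) : finite_dimQ V ->
  exists d (g h : {poly rat}), (forall v, pact T ('X^(d.+2) * g)%R v = 0%R) /\
    (forall v, v = (pact T g v + pact T ('X^(d.+2) * h) v)%R).
Proof.
move=> [n [e spanE]].
have /choice[c cE] : forall i, exists c : 'I_n -> rat, T (e i) = (\sum_j c j *: e j)%R.
  by move=> i; exact: spanE.
pose A : 'M[rat]_n := (\matrix_(i, j) c i j)%R.
(* Cayley-Hamilton for a spanning family that need not be independent: [X - A] kills the vector of
   the [e j], and multiplying by the adjugate shows that the characteristic polynomial kills each of
   them. *)
have chi_row i : (\sum_j pact T (char_poly_mx A i j) (e j) = 0)%R.
  rewrite (eq_bigr (fun j => pact T ('X *+ (i == j)) (e j) - A i j *: e j)%R) => [|j _].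
    rewrite sumrB (bigD1 i) //= eqxx pactX big1 => [|j]; last first.
      by rewrite eq_sym => /negbTE->; rewrite pact0.
    by rewrite addr0 cE -sumrB big1 // => j _; rewrite mxE subrr.
  by rewrite /char_poly_mx !mxE pactB pactC.
have chi0 k : pact T (char_poly A) (e k) = 0%R.
  transitivity (\sum_j pact T ((char_poly A)%:M k j) (e j))%R.
    rewrite (bigD1 k) //= mxE eqxx mulr1n big1 ?addr0 // => j.
    by rewrite mxE eq_sym => /negbTE->; rewrite pact0.
  rewrite /char_poly -mul_adj_mx.
  transitivity (\sum_i pact T (\adj (char_poly_mx A) k i)
    (\sum_j pact T (char_poly_mx A i j) (e j)))%R; last first.
    by apply: big1 => i _; rewrite chi_row raddf0.
  rewrite [RHS](eq_bigr (fun i => \sum_j pact T (\adj (char_poly_mx A) k i)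
    (pact T (char_poly_mx A i j) (e j)))%R) => [|i _]; last by rewrite raddf_sum.
  rewrite exchange_big; apply: eq_bigr => j _; rewrite [X in pact T X]mxE.
  rewrite (big_morph (fun p => pact T p (e j)) (fun p q => pactD T p q (e j)) (pact0 T (e j))).
  by apply: eq_bigr => i _; rewrite pactM.
have chiV v : pact T (char_poly A) v = 0%R.
  have [a ->] := spanE v; rewrite raddf_sum; apply: big1 => i _.
  by rewrite /= linearZ /= chi0 scaler0.
(* [d] is the multiplicity of the root 0; the larger exponent [d.+2] matches the truncation of the
   binomial series. *)
have [d [q]] := multiplicity_XsubC (char_poly A) 0%R.
rewrite monic_neq0 ?char_poly_monic //= subr0 => q0 chiE.
have : coprimep q ('X^(d.+2))%R by rewrite coprimep_expr // coprimepX.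
move/bezout_poly => [u uE]; exists d, (u.1 * q)%R, u.2; split=> v.
  have -> : ('X^(d.+2) * (u.1 * q) = 'X^2 * u.1 * char_poly A)%R.
    by rewrite chiE -[d.+2]add2n exprD mulrACA [(q * _)%R]mulrC.
  by rewrite pactM chiV raddf0.
by rewrite -pactD [('X^(d.+2) * _)%R]mulrC uE pact1.
Qed.

(** * Integral spans and lattices *)

Section IntegralSpan.
Variable M : zmodType.
Implicit Types (ys : seq M) (y z : M).

Fixpoint zspan ys z : Prop :=
  if ys is y :: ys' then exists a : int, zspan ys' (z - y *~ a)%R else z = 0%R.

Lemma zspan0 ys : zspan ys 0%R.
Proof. by elim: ys => //= y ys IHys; exists 0%R; rewrite mulr0z subr0. Qed.

Lemma zspanD ys z z' : zspan ys z -> zspan ys z' -> zspan ys (z + z')%R.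
Proof.
elim: ys z z' => [|y ys IHys] z z' /=; first by move=> -> ->; rewrite addr0.
move=> [a za] [b zb]; exists (a + b)%R; rewrite mulrzDr opprD addrACA; exact: IHys.
Qed.

Lemma zspanN ys z : zspan ys z -> zspan ys (- z)%R.
Proof.
elim: ys z => [|y ys IHys] z /=; first by move=> ->; rewrite oppr0.
by move=> [a /IHys za]; exists (- a)%R; rewrite mulrNz -opprD.
Qed.

Lemma zspanMn ys z k : zspan ys z -> zspan ys (z *+ k)%R.
Proof.
by move=> zs; elim: k => [|k IHk]; [exact: zspan0 | rewrite mulrS; exact: zspanD].
Qed.

Lemma zspanMz ys z (a : int) : zspan ys z -> zspan ys (z *~ a)%R.
Proof.
by case: a => k zs; [exact: zspanMn | rewrite NegzE mulrNz; exact/zspanN/zspanMn].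
Qed.

Lemma mem_zspan ys y : y \in ys -> zspan ys y.
Proof.
elim: ys => //= x ys IHys; rewrite inE => /orP[/eqP->|/IHys yys].
  by exists 1%R; rewrite mulr1z subrr; exact: zspan0.
by exists 0%R; rewrite mulr0z subr0.
Qed.

Lemma zspan_ind ys (P : M -> Prop) : P 0%R -> (forall z z', P z -> P z' -> P (z + z')%R) ->
  (forall z, P z -> P (- z)%R) -> (forall y, y \in ys -> P y) -> forall z, zspan ys z -> P z.
Proof.
move=> P0 PD PN; elim: ys => [_ z ->//|y ys IHys] Pys z /= [a za].
have -> : z = ((z - y *~ a) + y *~ a)%R by rewrite subrK.
apply: (PD); first by apply: IHys za => x xys; apply: Pys; rewrite inE xys orbT.
have Py n : P (y *+ n)%R.
  by elim: n => [|n IHn]; rewrite ?mulr0n // mulrS; apply: (PD) => //; exact/Pys/mem_head.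
by case: a {za} => n; [exact: Py | rewrite NegzE mulrNz; exact/PN/Py].
Qed.

Definition torsion z := exists2 k, (0 < k)%N & (z *+ k = 0)%R.

(** Adjoining [y] to a span whose [n]-th multiple is torsion-free: either a multiple of [y]
    lies in the span, or no torsion relation can involve [y]. *)
Lemma zspan_torsion ys : exists2 n, (0 < n)%N &
  forall z, zspan ys z -> torsion (z *+ n)%R -> (z *+ n = 0)%R.
Proof.
elim: ys => [|y ys [n n_gt0 nP]]; first by exists 1%N => // z /= ->; rewrite mul0rn.
have [[q q_gt0 yq]|noq] := pselect (exists2 q, (0 < q)%N & zspan ys (y *+ q)%R).
  exists (q * n)%N; first by rewrite muln_gt0 q_gt0.
  move=> z /= [a za]; rewrite mulrnA; apply: nP.
  have -> : (z *+ q = (z - y *~ a) *+ q + (y *+ q) *~ a)%R.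
    have -> : ((y *+ q) *~ a = y *~ a *+ q)%R by rewrite !pmulrn mulrzAC.
    by rewrite mulrnBl subrK.
  by apply: zspanD; [exact: zspanMn | exact: zspanMz].
exists n => // z /= [a za] [k k_gt0 zk].
(* A nonzero [a] would put the multiple of [y] by [|a| * n * k] into the span. *)
have a0 : a = 0%R.
  apply: contrapT => /eqP a0; apply: noq.
  exists (`|a| * n * k)%N; first by rewrite !muln_gt0 absz_gt0 a0 n_gt0.
  have ya : zspan ys (y *~ a *+ (n * k))%R.
    have -> : (y *~ a *+ (n * k) = - ((z - y *~ a) *+ (n * k)))%R.
      by rewrite mulrnBl [(z *+ (n * k))%R]mulrnA zk sub0r opprK.
    exact/zspanN/zspanMn.
  case: a a0 ya {za} => m _; rewrite /= -mulnA.
    by rewrite [(y *+ (m * _))%R]mulrnA.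
  by rewrite NegzE mulrNz mulNrn [(y *+ (m.+1 * _))%R]mulrnA => /zspanN; rewrite opprK.
by move: za; rewrite a0 mulr0z subr0 => za; apply: nP => //; exists k.
Qed.

End IntegralSpan.

Section IterAdditive.
Variables (M : zmodType) (f : {additive M -> M}) (n : nat).

Lemma iter_raddf0 : iter n f 0%R = 0%R.
Proof. by elim: n => //= k ->; rewrite raddf0. Qed.
Lemma iter_raddfD x y : iter n f (x + y)%R = (iter n f x + iter n f y)%R.
Proof. by elim: n => //= k ->; rewrite raddfD. Qed.
Lemma iter_raddfN x : iter n f (- x)%R = (- iter n f x)%R.
Proof. by elim: n => //= k ->; rewrite raddfN. Qed.
Lemma iter_raddfMn x k : iter n f (x *+ k)%R = (iter n f x *+ k)%R.
Proof. by elim: n => //= j ->; rewrite raddfMn. Qed.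

End IterAdditive.

Section Rationalization.
Variable M : zmodType.
Local Notation V := (tensQ (Algebra.to_multiplicative M)).

Definition inQ (m : M) : V := tensQ_in (m : Algebra.to_multiplicative M).

Lemma inQ_is_additive : {morph inQ : x y / (x - y)%R}.
Proof.
by move=> x y; rewrite -[RHS]/(tensQ_in _ + - tensQ_in _)%R -tensQ_inV -tensQ_inM.
Qed.
HB.instance Definition _ := GRing.isZmodMorphism.Build M V inQ inQ_is_additive.

Lemma inQ_torsion m : inQ m = 0%R -> torsion m.
Proof.
have mulXE (y : M) n : (y *+ n)%R = (y : Algebra.to_multiplicative M) ^+ n.
  by elim: n => // n IHn; rewrite mulrS expgS IHn.
move/tensQ_in_eq0 => [|k k_gt0 mk]; first exact: (@addrC M).
by exists k; rewrite ?mulXE.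
Qed.

Lemma inQ_frac v : exists2 q, (0 < q)%N & exists m, (v *+ q)%R = inQ m.
Proof. exact: (tensQ_frac v (@addrC M)). Qed.

Lemma inQ_lift (f : {additive M -> M}) :
  exists T : {linear V -> V}, forall m, T (inQ m) = inQ (f m).
Proof.
have [T TE] := @tensQ_lift (Algebra.to_multiplicative M) V (fun m => inQ (f m))
  (fun x y => etrans (congr1 inQ (raddfD f x y)) (raddfD inQ _ _)).
by exists T => m; rewrite -TE.
Qed.

Section Lattice.
Variables (f : {additive M -> M}) (T : {linear V -> V}) (TE : forall m, T (inQ m) = inQ (f m)).
Variables (d : nat) (g : {poly rat}).
Hypothesis fin_dim : finite_dimQ V.
Hypothesis gd : forall v, pact T ('X^d * g)%R v = 0%R.

Lemma inQ_iter n m : inQ (iter n f m) = iter n T (inQ m).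
Proof. by elim: n => //= n <-; rewrite TE. Qed.

(** A multiple of each [g(T) e_i] lifts to some [y i] in [M] killed by [f^d]. The span of the
    iterates of the [y i] is stable under [f], and a suitable multiple of it is torsion-free. *)
Lemma lattice : exists L : M -> Prop,
  [/\ L 0%R, (forall x y, L x -> L y -> L (x + y)%R), (forall x, L x -> L (- x)%R),
   (forall x, L x -> L (f x)) & forall x, L x -> iter d f x = 0%R] /\
  (forall x, L x -> torsion x -> x = 0%R) /\
  forall v, exists2 q, (0 < q)%N & exists2 l, L l & (pact T g v *+ q)%R = inQ l.
Proof.
have [n [e spanE]] := fin_dim.
have /choice[y yP] : forall i, exists y, iter d f y = 0%R /\
    exists2 q, (0 < q)%N & (pact T g (e i) *+ q)%R = inQ y.
  move=> i; have [q q_gt0 [y yE]] := inQ_frac (pact T g (e i)).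
  (* The relation on [g] shows only that [iter d f y] is torsion; replacing [y] by a multiple makes
     it zero. *)
  have [|k k_gt0 ky] := @inQ_torsion (iter d f y).
    by rewrite inQ_iter -yE raddfMn /= -pactXn -pactM gd mul0rn.
  exists (y *+ k)%R; split; first by rewrite iter_raddfMn.
  exists (q * k)%N; first by rewrite muln_gt0 q_gt0.
  by rewrite mulrnA yE raddfMn.
pose ys := [seq iter j f (y i) | i <- enum 'I_n, j <- iota 0 d].
have ysf z : zspan ys z -> zspan ys (f z).
  apply: (zspan_ind (P := fun z => zspan ys (f z))) => [|||_ /allpairsP[[i j] /= [_ jd ->]]].
  - by rewrite raddf0; exact: zspan0.
  - by move=> u v fu fv; rewrite raddfD; exact: zspanD.
  - by move=> u fu; rewrite raddfN; exact: zspanN.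
  rewrite mem_iota add0n in jd; have [jd'|dj] := ltnP j.+1 d.
    by apply: (@mem_zspan _ ys); apply/allpairsP; exists (i, j.+1); rewrite /= mem_enum mem_iota.
  have dE : j.+1 = d by apply/eqP; rewrite eqn_leq dj andbT; case/andP: jd.
  rewrite -iterS dE.
  by have [-> _] := yP i; exact: zspan0.
have ysd z : zspan ys z -> iter d f z = 0%R.
  apply: (zspan_ind (P := fun z => iter d f z = 0%R)) => [|||_ /allpairsP[[i j] /= [_ jd ->]]].
  - exact: iter_raddf0.
  - by move=> u v u0 v0; rewrite iter_raddfD u0 v0 addr0.
  - by move=> u u0; rewrite iter_raddfN u0 oppr0.
  by rewrite -iterD addnC iterD; have [-> _] := yP i; rewrite iter_raddf0.
have [N N_gt0 NP] := zspan_torsion ys.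
exists (fun x => exists2 z, zspan ys z & x = z *+ N)%R; split; first split.
- by exists 0%R; rewrite ?mul0rn //; exact: zspan0.
- by move=> _ _ [x xs ->] [z zs ->]; exists (x + z)%R; rewrite ?mulrnDl //; exact: zspanD.
- by move=> _ [x xs ->]; exists (- x)%R; rewrite ?mulNrn //; exact: zspanN.
- by move=> _ [x xs ->]; exists (f x); rewrite ?raddfMn //; exact: ysf.
- by move=> _ [x xs ->]; rewrite iter_raddfMn ysd ?mul0rn.
split=> [_ [x xs ->]|v]; first exact: NP.
pose P v := exists2 q, (0 < q)%N & exists2 l, zspan ys l & (v *+ q = inQ l)%R.
suff [q q_gt0 [l ls lE]] : P (pact T g v).
  exists (q * N)%N; first by rewrite muln_gt0 q_gt0.
  by exists (l *+ N)%R; [exists l | rewrite mulrnA lE raddfMn].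
have PD u w : P u -> P w -> P (u + w)%R.
  move=> [q q_gt0 [l ls uE]] [q' q'_gt0 [l' l's wE]].
  exists (q * q')%N; first by rewrite muln_gt0 q_gt0.
  exists (l *+ q' + l' *+ q)%R; first by apply: zspanD; exact: zspanMn.
  by rewrite raddfD !raddfMn /= -uE -wE mulrnDl -!mulrnA [(q' * q)%N]mulnC.
have PZ a u : P u -> P (a *: u)%R.
  move=> [q q_gt0 [l ls uE]].
  have := denq_gt0 a; case aE : (denq a) => [q'|//]; rewrite ltz_nat => q'_gt0.
  exists (q' * q)%N; first by rewrite muln_gt0 q'_gt0.
  exists (l *~ numq a)%R; first exact: zspanMz.
  by rewrite mulrnA (scale_denq u aE) raddfMz /= -uE !pmulrn mulrzAC.
have [c ->] := spanE v; rewrite raddf_sum; apply: (big_ind P) => [||i _].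
- by exists 1%N => //; exists 0%R; [exact: zspan0 | rewrite mul0rn raddf0].
- exact: PD.
have [_ [q q_gt0 qE]] := yP i.
rewrite /= linearZ; apply: PZ; exists q => //; exists (y i) => //.
(* For [d = 0] no iterates are listed, but then [y i] itself is zero. *)
have [d0|d_gt0] := posnP d.
  rewrite -[y i]/(iter 0 f (y i)) -d0; have [-> _] := yP i; exact: zspan0.
by apply: (@mem_zspan _ ys); apply/allpairsP; exists (i, 0%N); rewrite /= mem_enum mem_iota.
Qed.

End Lattice.
End Rationalization.

(** * The Q-completion *)

Lemma quotg_lift (G E : groupType) (N : normalClosed G) (psi : {multiplicative G -> E}) :
  (forall x, x \in N -> psi x = 1) ->
  exists f : {multiplicative quotg N -> E}, forall x, f (quotg_pi N x) = psi x.
Proof.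
move=> psiN; pose f (y : quotg N) := psi (repr y).
have fE x : f (quotg_pi N x) = psi x.
  apply: (mulgI (psi x)^-1); rewrite mulVg -gmorphV -gmulfM; apply: psiN.
  by apply/quotg_eqP; rewrite reprK.
have fM : {morph f : x y / x * y}.
  elim/quotW=> x; elim/quotW=> y; rewrite -!/(quotg_pi N _) !fE -gmulfM -fE.
  by congr f; rewrite [RHS]gmulfM.
by exists (mulmorph fM) => x; rewrite /= fE.
Qed.

Lemma uniquely_divisible_torsion_free (G : groupType) (x : G) n :
  uniquely_divisible G -> (0 < n)%N -> x ^+ n = 1 -> x = 1.
Proof.
by move=> /uniquely_divisibleP divG /divG[inj _] xn; apply: inj; rewrite xn expg1n.
Qed.

Section QTower.
Variables (G : groupType) (X : qtower G).

Definition tower_in i : {multiplicative G -> X i} := qtower_in X i \o quotg_pi (gammaQ G i).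

(** Once [psi] kills [gammaQ G i], the universal property factors it through level [i] of the
    tower. *)
Lemma tower_in_kernel (E : groupType) (psi : {multiplicative G -> E}) i x :
  nilpotentg E -> uniquely_divisible E -> (forall y, y \in gammaQ G i -> psi y = 1) ->
  tower_in i x = 1 -> psi x = 1.
Proof.
move=> nilE divE /quotg_lift[f fE] x1.
have [g [gE _]] := malcev_universal (qtower_inP X i) f nilE divE.
by rewrite -fE -gE -[qtower_in X i _]/(tower_in i x) x1 gmorph1.
Qed.

Definition qcompl_proj_fun i (x : qcompl X) : X i := x i.
Lemma qcompl_proj_funM i : {morph qcompl_proj_fun i : x y / x * y}. Proof. by []. Qed.
Definition qcompl_proj i : {multiplicative qcompl X -> X i} := mulmorph (@qcompl_proj_funM i).

Variables (F : groupClosed G) (i0 : nat).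
Local Notation tower_F i := (tower_in i \o sgval_morph F).
Hypothesis tower_inj : forall i x, (i0 <= i)%N -> x \in F -> tower_in i x = 1 -> x = 1.
Hypothesis tower_root : forall i x, root_in (image_closed (tower_F i)) (tower_in i x).

Lemma tower_root_dense i (x : X i) : root_in (image_closed (tower_F i)) x.
Proof.
have [m m_gt0 /image_closedP[y yE]] := malcev_root_dense x (qtower_inP X i).
have [k k_gt0 xk] : root_in (image_closed (tower_F i)) (x ^+ m).
  by rewrite -yE; elim/quotW: {yE} y => y; exact: (tower_root i y).
by exists (m * k)%N; rewrite ?muln_gt0 ?m_gt0 // expgnA.
Qed.

(** Triviality climbs from level [i] to [i.+1]: a power of [x i.+1] comes from some [u] in [F] that
    dies at level [i], so [u] is trivial, and [X i.+1] has no torsion. Below [i0] the projections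
    suffice. *)
Lemma qcompl_proj_inj : injective (qcompl_proj i0).
Proof.
apply: gmorph_inj => x x1.
have xi i : (i0 <= i)%N -> x i = 1.
  elim: i => [|i IHi]; first by rewrite leqn0 => /eqP i00; rewrite -i00 in x1 *.
  rewrite leq_eqVlt => /orP[/eqP i0i|]; first by rewrite -i0i in x1 *.
  rewrite ltnS => i0i; have [m m_gt0 /image_closedP[u uE]] := tower_root_dense (x i.+1).
  apply: (uniquely_divisible_torsion_free (malcev_divisible (qtower_inP X i.+1)) m_gt0).
  suff u1 : sgval_morph F u = 1 by rewrite -uE /= -[val u]/(sgval_morph F u) u1 gmorph1.
  apply: (tower_inj i0i (valP u)); 
  rewrite -[LHS]/(qtower_in X i (quotg_pi _ (val u))) -qtower_projP.
  rewrite -[qtower_in X i.+1 _]/((tower_F i.+1) u) uE.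
  by rewrite gmorphX qcompl_projP IHi ?expg1n.
apply: qcompl_eqP => i; have [/xi//|/ltnW ii0] := leqP i0 i.
have : x i0 = 1 by exact: x1.
elim: {x1 xi} i0 ii0 => [|j IHj]; first by rewrite leqn0 => /eqP->.
rewrite leq_eqVlt => /orP[/eqP->//|ij xj]; apply: IHj => //.
by rewrite -qcompl_projP xj gmorph1.
Qed.

Theorem qcompl_homology_surjective n (y : homology (qcompl X) n) :
  exists x : homology G n, homology_map (qcompl_in X) x = y.
Proof.
pose phi : {multiplicative subgroup F -> qcompl X} := qcompl_in X \o sgval_morph F.
have phiE i u : qcompl_proj i (phi u) = tower_F i u by [].
have phi_inj : injective phi.
  apply: gmorph_inj => u u1; apply: val_inj; rewrite val1.
  by apply: (tower_inj (leqnn i0) (valP u)); rewrite -[LHS](phiE i0 u) u1.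
have nil : nilpotentg (qcompl X).
  exact: nilpotent_inj qcompl_proj_inj (malcev_nilpotent (qtower_inP X i0)).
have root x : root_in (image_closed phi) x.
  have [m m_gt0 /image_closedP[u uE]] := tower_root_dense (x i0).
  exists m => //; apply/image_closedP; exists u; apply: qcompl_proj_inj.
  by rewrite phiE uE gmorphX.
have [x <-] := root_dense_homology phi_inj nil root y.
exists (homology_map (sgval_morph F) x); elim/quotW: x => z.
rewrite -[\pi z]/(homology_class z) (homology_mapE (sgval_morph F)) (homology_mapE phi).
rewrite homology_mapE; congr homology_class; apply: val_inj => /=.
exact: bar_map_comp.
Qed.

End QTower.

(** * The Fitting projection, the semidirect product and the conclusion *)

Section FittingProjection.
Variables (V : lmodType rat) (T : {linear V -> V}) (d : nat) (g h : {poly rat}).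
Hypothesis gd : forall v, pact T ('X^(d.+2) * g)%R v = 0%R.
Hypothesis gh : forall v, v = (pact T g v + pact T ('X^(d.+2) * h) v)%R.

Lemma fitting_idem v : pact T g (pact T g v) = pact T g v.
Proof.
rewrite [RHS]gh; have -> : pact T ('X^(d.+2) * h)%R (pact T g v) =
    pact T h (pact T ('X^(d.+2) * g)%R v).
  by rewrite -!pactM; congr pact; rewrite mulrAC mulrC.
by rewrite gd raddf0 addr0.
Qed.

Lemma fitting_nilpotent v : iter d.+2 (pact T ('X * g)%R) v = 0%R.
Proof.
have -> : forall n, iter n (pact T ('X * g)%R) v = pact T ('X^n * g ^+ n)%R v.
  by elim=> [|n IHn]; rewrite ?mulr1 ?pact1 //= IHn -pactM -exprMn -exprS exprMn.
by rewrite [(g ^+ _)%R]exprS mulrA mulrC pactM gd raddf0.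
Qed.

Lemma fitting_fixed v : iter d.+2 T v = 0%R -> pact T g v = v.
Proof. by move=> v0; rewrite [RHS]gh mulrC pactM pactXn v0 raddf0 addr0. Qed.

(** When [g(T)] kills [v], the operator [T^(d+2) h(T)] fixes [v]; its [n]-th power contains the
    factor [T^n]. *)
Lemma fitting_kernel v n : pact T g v = 0%R -> exists w, v = iter n T w.
Proof.
move=> v0; exists (pact T ('X^(d.+1 * n) * h ^+ n)%R v).
have {1}-> : v = pact T (('X^(d.+2) * h) ^+ n)%R v.
  elim: n => [|n IHn]; first by rewrite pact1.
  by rewrite exprSr pactM {1}IHn; congr (pact _ _ _); rewrite [LHS]gh v0 add0r.
by rewrite -pactXn -pactM mulrA -exprD exprMn -exprM mulSn.
Qed.

End FittingProjection.

Section SemidirectZ.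
Variables (C : groupType) (M : zmodType) (act : gmodule C M).
Local Notation G := (semidirect act).

Definition diff (t : C) (m : M) : M := (act t m - m)%R.

Lemma diff_is_additive t : {morph diff t : x y / (x - y)%R}.
Proof. by move=> x y; rewrite /diff gactD gactN !opprD !opprK addrACA. Qed.
HB.instance Definition _ t := GRing.isZmodMorphism.Build M M (diff t) (diff_is_additive t).

(** On [M], the operator [t - 1] is the commutator with [t^-1], so each application descends one
    term. *)
Lemma diff_lcn t n m : ((iter n (diff t) m, 1) : G) \in lcn G n.
Proof.
elim: n => // n IHn; set z := iter n _ m in IHn *.
have -> : ((iter n.+1 (diff t) m, 1) : G) = [~ (z, 1) : G, (0%R, t^-1) : G].
  apply: (mulgI (((0%R, t^-1) : G) * (z, 1))); rewrite -commgC; congr (_, _).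
    rewrite /= gact1 !addr0 add0r mulg1 gactD gactN -gactM mulVg gact1 -/z.
    by rewrite addrC subrK.
  by rewrite /= mulg1 mul1g mulg1.
exact: mem_commG.
Qed.

Lemma semidirect_expg (m : M) n : ((m, 1) : G) ^+ n = ((m *+ n)%R, 1).
Proof.
elim: n => // n IHn; rewrite expgS IHn mulrS; congr (_, _); last exact: mulg1.
by rewrite /= gact1.
Qed.

End SemidirectZ.

Theorem proposition5p7 (C : groupType) (M : zmodType)
    (act : gmodule C M) (HC : infinite_cyclic C)
    (HM : finite_dimQ (tensQ (Algebra.to_multiplicative M)))
    (X : qtower (semidirect act)) (n : nat) :
  forall y : homology (qcompl X) n,
    exists x : homology (semidirect act) n, homology_map (qcompl_in X) x = y.
Proof.
have [t [ex [exM ext ex0 tP]]] := infinite_cyclic_exponent HC.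
have [T TE] := inQ_lift (diff act t).
have [d [g [h [gd gh]]]] := fitting_decomposition T HM.
have [L [[L0 LD LN Lf Ld] [Ltor Lspan]]] := lattice TE HM gd.
(* [S] agrees with [T] on the nilpotent summand and vanishes on the complementary one. *)
pose S : {linear _ -> _} := pact T ('X * g)%R.
have S_nil v : iter d.+2 S v = 0%R by exact: fitting_nilpotent.
pose E := semidirect (unip S_nil).
have ex1 : ex 1 = 0%R by apply: (addrI (ex 1)); rewrite -exM mulg1 addr0.
have pi_t m : pact T g (inQ (act t m)) = unip S_nil (1%R : rat) (pact T g (inQ m)).
  have -> : act t m = (m + diff act t m)%R by rewrite /diff addrC subrK.
  rewrite [RHS]unip1 raddfD /= raddfD /= -TE; congr (_ + _)%R.
  by rewrite [RHS]pactM pactX (fitting_idem gd gh) -!(pactX T) pact_comm.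
pose eqv c := forall m, pact T g (inQ (act c m)) = unip S_nil (ex c) (pact T g (inQ m)).
have eqvM c c' : eqv c -> eqv c' -> eqv (c * c').
  by move=> cE c'E m; rewrite gactM cE c'E exM -gactM.
have eqv1 : eqv 1 by move=> m; rewrite gact1 ex1 gact1.
have eqvV c : eqv c -> eqv c^-1.
  move=> cE m; have e0 : ((ex c^-1 : Algebra.to_multiplicative rat) * ex c = 1)%g.
    by rewrite -[LHS]/(ex c^-1%g + ex c)%R -exM mulVg ex1.
  by rewrite -[LHS](gact1 (unip S_nil)) -e0 gactM -cE -gactM mulgV gact1.
have eqvt : eqv t by move=> m; rewrite pi_t ext.
have eqvX k : eqv (t ^+ k).
  by elim: k => [|k IHk]; rewrite ?expg0 // expgS; exact: eqvM.
have eqvA c : eqv c.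
  by have [k [->|->]] := tP c; [exact: eqvX | exact/eqvV/eqvX].
pose psi (x : semidirect act) : E := (pact T g (inQ x.1), ex x.2).
have psiM : {morph psi : x y / x * y}.
  move=> x y; congr (_, _); last exact: exM.
  by rewrite /= raddfD /= raddfD /= eqvA.
have Lt x : L x -> L (act t x).
  by move=> Lx; have -> : act t x = (x + diff act t x)%R; [rewrite /diff addrC subrK | exact/LD/Lf].
(* Induction on the power of [t - 1] that kills [x], through [t^-1 x = x - t^-1 (t - 1) x]. *)
have LtV x : L x -> L (act t^-1 x).
  move=> Lx; move: (d.+2) (Ld x Lx) => k; elim: k x Lx => [|k IHk] x Lx xk.
    by rewrite [x]xk gact0.
  have -> : act t^-1 x = (x - act t^-1%g (diff act t x))%R.
    by rewrite /diff gactD gactN -gactM mulVg gact1 subKr.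
  by apply/LD/LN/IHk => //; [exact: Lf | rewrite -iterSr].
have LX s k x : (forall x, L x -> L (act s x)) -> L x -> L (act (s ^+ k) x).
  move=> Ls Lx; elim: k => [|k IHk]; first by rewrite expg0 gact1.
  by rewrite expgS gactM; exact: Ls.
have Lact c x : L x -> L (act c x).
  by have [k [->|->]] := tP c; rewrite -?expVgn; exact: LX.
pose P (x : semidirect act) := L x.1.
have PM x y : P x -> P y -> P (x * y) by move=> Lx Ly; apply: LD => //; exact: Lact.
have PV x : P x -> P x^-1 by move=> Lx; apply: LN; exact: Lact.
pose F : groupClosed (semidirect act) := subgroup_of (P := P) L0 PM PV.
have FP x : reflect (P x) (x \in F) by exact: subgroup_ofP.
have pi_L l : L l -> pact T g (inQ l) = inQ l.
  by move=> Ll; apply: (fitting_fixed gh); rewrite -(inQ_iter TE) Ld // raddf0.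
(* From index [d.+3] on the filtration of [E] is trivial, so [psi] kills [gammaQ] there. *)
apply: (@qcompl_homology_surjective _ X F d.+3) => [i x di /FP Lx x1 | i [m c]].
  have: mulmorph psiM x = 1.
    apply: (tower_in_kernel (unip_nilpotent S_nil) (unip_uniquely_divisible S_nil)) x1 => y yi.
    apply: (unip_filtration_top di); move: i y yi {di}; apply: gammaQ_filtration.
    - exact: unip_filtration0.
    - exact: unip_filtration_commg.
    - by move=> i y k k_gt0 _; exact: unip_filtration_root.
  (* On [F] the map [psi] sends [(m, c)] to [(inQ m, ex c)], which is injective because [L] is
     torsion-free. *)
  case: x Lx {x1} => m c; rewrite /P /= => Lm [/=]; rewrite pi_L //.
  by move=> /inQ_torsion/(Ltor _ Lm)-> /ex0->.
have nilX := malcev_nilpotent (qtower_inP X i).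
apply/(root_closureP _ nilX).
(* Roots form a subgroup and [(0, c)] lies in [F], so only [(m, 1)] remains. *)
have -> : (m, c) = ((m, 1) : semidirect act) * (0%R, c).
  by congr (_, _); rewrite /= ?gact0 ?addr0 ?mul1g.
rewrite gmulfM; apply: gpredM; apply/root_closureP; last first.
  exists 1%N => //; have cF : ((0%R, c) : semidirect act) \in F by apply/FP.
  by apply/image_closedP; exists (Subgroup cF).
have [q q_gt0 [l Ll lE]] := Lspan (inQ m).
exists q => //; have lF : ((l, 1) : semidirect act) \in F by apply/FP.
apply/image_closedP; exists (Subgroup lF); rewrite -[LHS]/(tower_in X i (l, 1)).
rewrite -gmorphX semidirect_expg.
(* The part of [m *+ q] in the complementary summand; it must die in [X i]. *)
pose z0 := (m *+ q - l)%R.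
have -> : ((m *+ q)%R, 1) = ((z0, 1) : semidirect act) * (l, 1).
  by congr (_, _); rewrite /= ?gact1 ?subrK ?mulg1.
rewrite gmulfM; suff -> : tower_in X i (z0, 1) = 1 by rewrite mul1g.
have pi_z0 : pact T g (inQ z0) = 0%R.
  by rewrite raddfB raddfMn /= raddfB raddfMn /= lE pi_L // subrr.
have [K KP] := (nilpotentP _).1 nilX.
have [w wE] := fitting_kernel gh K pi_z0; have [b b_gt0 [z zE]] := inQ_frac w.
(* Clearing denominators: a positive multiple of [z0] is a value of [(t - 1)^K], hence lies in a
   lower central term that is trivial in [X i], which has no torsion. *)
have [k k_gt0 kE] : torsion (z0 *+ b - iter K (diff act t) z)%R.
  apply: inQ_torsion; rewrite raddfB /= raddfMn /= wE (inQ_iter TE) -zE.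
  by rewrite raddfMn subrr.
apply: (@uniquely_divisible_torsion_free _ _ (b * k)).
- exact: malcev_divisible (qtower_inP X i).
- by rewrite muln_gt0 b_gt0.
rewrite -gmorphX semidirect_expg; apply: KP; apply: lcn_morph.
have -> : (z0 *+ (b * k) = iter K (diff act t) (z *+ k))%R.
  by rewrite iter_raddfMn mulrnA; apply/eqP; rewrite -subr_eq0 -mulrnBl kE.
exact: diff_lcn.
Qed.
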